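(* Let $p,q\in(0,1)$ and let $\mathcal{H}$ be a separable Hilbert space with an orthonormal basis $\{e_k\}_{k\geq 0}$. Any irreducible $*$-representation of $\mathcal{O}(S^3_{pq})$ in bounded operators on a Hilbert space is unitarily equivalent to one of the following: \[ \rho_{1\theta}(a)e_k=e^{i\theta}e_k,\quad \rho_{1\theta}(b)e_k=\sqrt{1-p^{k+1}}\,e_{k+1},\quad k\geq 0,\quad \theta\in[0,2\pi) \] (a representation on $\mathcal{H}$); \[ \rho_{2\theta}(a)e_k=\sqrt{1-q^{k+1}}\,e_{k+1},\quad \rho_{2\theta}(b)e_k=e^{i\theta}e_k,\quad k\geq 0,\quad \theta\in[0,2\pi) \] (a representation on $\mathcal{H}$); \[ \rho_{\theta_1\theta_2}(a)=e^{i\theta_1},\quad \rho_{\theta_1\theta_2}(b)=e^{i\theta_2},\quad \theta_1,\theta_2\in[0,2\pi) \] (a one-dimensional representation on $\mathbb{C}$).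
   Context: For $p,q\in(0,1)$, $\mathcal{O}(S^3_{pq})$ is the universal unital $*$-algebra over $\mathbb{C}$ generated by $a$ and $b$ subject to the relations \[ a^*a-q\,aa^*=1-q,\qquad b^*b-p\,bb^*=1-p,\qquad ab=ba,\qquad a^*b=ba^*,\qquad (1-aa^* )(1-bb^* )=0 . \] A $*$-representation in bounded operators is a unital $*$-homomorphism into $B(\mathcal{K})$ for a nonzero complex Hilbert space $\mathcal{K}$; it is irreducible if it has no closed invariant subspaces other than $0$ and $\mathcal{K}$. *)

(* Defs.v *)
From HB Require Import structures.
From mathcomp Require Import all_boot all_order all_algebra.
From mathcomp Require Import generic_quotient complex.
From mathcomp Require Import all_classical all_reals all_analysis.

Set Implicit Arguments.
Unset Strict Implicit.
Unset Printing Implicit Defensive.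

Import Order.TTheory GRing.Theory Num.Theory.
Import numFieldNormedType.Exports.

Local Open Scope classical_set_scope.
Local Open Scope ring_scope.
Local Open Scope complex_scope.

HB.mixin Record isStarAlgebra (C : numClosedFieldType) A
    of GRing.Algebra C A := {
  star : A -> A;
  starK : involutive star;
  starD : {morph star : x y / x + y};
  starZ : forall (c : C) (x : A), star (c *: x) = Num.conj c *: star x;
  starM : forall x y : A, star (x * y) = star y * star x
}.

#[short(type="starAlgType")]
HB.structure Definition StarAlgebra (C : numClosedFieldType) :=
  {A of isStarAlgebra C A & GRing.Algebra C A}.

Lemma star1 (C : numClosedFieldType) (A : starAlgType C) : star (1 : A) = 1.
Proof.
by rewrite -[LHS]mulr1 -[X in _ * X = _](starK 1) -starM mulr1 starK.
Qed.

Lemma star0 (C : numClosedFieldType) (A : starAlgType C) : star (0 : A) = 0.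
Proof. by rewrite -[X in star X](scale0r 0) starZ conjC0 scale0r. Qed.

Lemma starN (C : numClosedFieldType) (A : starAlgType C) (x : A) :
  star (- x) = - star x.
Proof. by rewrite -scaleN1r starZ rmorphN1 scaleN1r. Qed.

HB.instance Definition _ (C : numClosedFieldType) :=
  isStarAlgebra.Build C C^o (@conjCK C) (@rmorphD C C _)
    (fun c x => rmorphM _ c x)
    (fun x y => etrans (rmorphM _ x y) (mulrC _ _)).

Definition sphere_rel (R : realType) (p q : R) (A : starAlgType R[i])
    (a b : A) : Prop :=
  [/\ star a * a - q%:C *: (a * star a) = (1 - q)%:C *: 1,
      star b * b - p%:C *: (b * star b) = (1 - p)%:C *: 1,
      a * b = b * a,
      star a * b = b * star a
    & (1 - a * star a) * (1 - b * star b) = 0].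

(* O(S^3_pq) is built as the *-polynomial expressions in the two generators    *)
(* modulo the least congruence containing the axioms of unital *-algebras over *)
(* C and the five defining relations; Osphere_universal below is its universal *)
(* property.                                                                   *)
Section Osphere.
Variable R : realType.
Local Notation C := R[i].

Inductive star_expr : Type :=
| EGenA | EGenB | EZero | EOne
| EAdd of star_expr & star_expr
| EOpp of star_expr
| EMul of star_expr & star_expr
| EScale of C & star_expr
| EStar of star_expr.

HB.instance Definition _ := gen_eqMixin star_expr.
HB.instance Definition _ := gen_choiceMixin star_expr.

Variables p q : R.

Local Notation "x ⊕ y" := (EAdd x y) (at level 50, left associativity).
Local Notation "x ⊖ y" := (EAdd x (EOpp y)) (at level 50, left associativity).
Local Notation "x ⊗ y" := (EMul x y) (at level 40, left associativity).
Local Notation "c ⊙ x" := (EScale c x) (at level 40, left associativity).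

Inductive star_congr : star_expr -> star_expr -> Prop :=
| congr_refl x : star_congr x x
| congr_sym x y : star_congr x y -> star_congr y x
| congr_trans x y z : star_congr x y -> star_congr y z -> star_congr x z
| congr_add x x' y y' :
    star_congr x x' -> star_congr y y' -> star_congr (x ⊕ y) (x' ⊕ y')
| congr_opp x x' : star_congr x x' -> star_congr (EOpp x) (EOpp x')
| congr_mul x x' y y' :
    star_congr x x' -> star_congr y y' -> star_congr (x ⊗ y) (x' ⊗ y')
| congr_scale c x x' : star_congr x x' -> star_congr (c ⊙ x) (c ⊙ x')
| congr_star x x' : star_congr x x' -> star_congr (EStar x) (EStar x')
| congr_addA x y z : star_congr (x ⊕ (y ⊕ z)) (x ⊕ y ⊕ z)
| congr_addC x y : star_congr (x ⊕ y) (y ⊕ x)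
| congr_add0 x : star_congr (EZero ⊕ x) x
| congr_addN x : star_congr (EOpp x ⊕ x) EZero
| congr_mulA x y z : star_congr (x ⊗ (y ⊗ z)) (x ⊗ y ⊗ z)
| congr_mul1l x : star_congr (EOne ⊗ x) x
| congr_mul1r x : star_congr (x ⊗ EOne) x
| congr_mulDl x y z : star_congr ((x ⊕ y) ⊗ z) (x ⊗ z ⊕ y ⊗ z)
| congr_mulDr x y z : star_congr (x ⊗ (y ⊕ z)) (x ⊗ y ⊕ x ⊗ z)
| congr_scaleA c d x : star_congr (c ⊙ (d ⊙ x)) ((c * d) ⊙ x)
| congr_scale1 x : star_congr (1 ⊙ x) x
| congr_scaleDr c x y : star_congr (c ⊙ (x ⊕ y)) (c ⊙ x ⊕ c ⊙ y)
| congr_scaleDl c d x : star_congr ((c + d) ⊙ x) (c ⊙ x ⊕ d ⊙ x)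
| congr_scaleAl c x y : star_congr (c ⊙ (x ⊗ y)) ((c ⊙ x) ⊗ y)
| congr_scaleAr c x y : star_congr (c ⊙ (x ⊗ y)) (x ⊗ (c ⊙ y))
| congr_starK x : star_congr (EStar (EStar x)) x
| congr_starD x y : star_congr (EStar (x ⊕ y)) (EStar x ⊕ EStar y)
| congr_starZ c x : star_congr (EStar (c ⊙ x)) (Num.conj c ⊙ EStar x)
| congr_starM x y : star_congr (EStar (x ⊗ y)) (EStar y ⊗ EStar x)
| congr_relA :
    star_congr (EStar EGenA ⊗ EGenA ⊖ q%:C ⊙ (EGenA ⊗ EStar EGenA))
               ((1 - q)%:C ⊙ EOne)
| congr_relB :
    star_congr (EStar EGenB ⊗ EGenB ⊖ p%:C ⊙ (EGenB ⊗ EStar EGenB))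
               ((1 - p)%:C ⊙ EOne)
| congr_relAB : star_congr (EGenA ⊗ EGenB) (EGenB ⊗ EGenA)
| congr_relSAB : star_congr (EStar EGenA ⊗ EGenB) (EGenB ⊗ EStar EGenA)
| congr_relP :
    star_congr ((EOne ⊖ EGenA ⊗ EStar EGenA) ⊗ (EOne ⊖ EGenB ⊗ EStar EGenB))
               EZero.

Fixpoint star_eval (A : starAlgType C) (a b : A) (t : star_expr) : A :=
  match t with
  | EGenA => a
  | EGenB => b
  | EZero => 0
  | EOne => 1
  | EAdd x y => star_eval a b x + star_eval a b y
  | EOpp x => - star_eval a b x
  | EMul x y => star_eval a b x * star_eval a b y
  | EScale c x => c *: star_eval a b x
  | EStar x => star (star_eval a b x)
  end.

Lemma star_eval_congr (A : starAlgType C) (a b : A) :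
  sphere_rel p q a b ->
  forall x y, star_congr x y -> star_eval a b x = star_eval a b y.
Proof.
move=> [ra rb rab rsab rp] x y; elim=> //= {x y}.
- by move=> x y z _ -> _ ->.
- by move=> x x' y y' _ -> _ ->.
- by move=> x x' _ ->.
- by move=> x x' y y' _ -> _ ->.
- by move=> c x x' _ ->.
- by move=> x x' _ ->.
- by move=> x y z; rewrite addrA.
- by move=> x y; rewrite addrC.
- by move=> x; rewrite add0r.
- by move=> x; rewrite addNr.
- by move=> x y z; rewrite mulrA.
- by move=> x; rewrite mul1r.
- by move=> x; rewrite mulr1.
- by move=> x y z; rewrite mulrDl.
- by move=> x y z; rewrite mulrDr.
- by move=> c d x; rewrite scalerA.
- by move=> x; rewrite scale1r.
- by move=> c x y; rewrite scalerDr.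
- by move=> c d x; rewrite scalerDl.
- by move=> c x y; rewrite scalerAl.
- by move=> c x y; rewrite scalerAr.
- by move=> x; rewrite starK.
- by move=> x y; rewrite starD.
- by move=> c x; rewrite starZ.
- by move=> x y; rewrite starM.
Qed.

Definition star_equiv (x y : star_expr) : bool := `[< star_congr x y >].

Lemma star_equiv_refl : reflexive star_equiv.
Proof. by move=> x; apply/asboolP; exact: congr_refl. Qed.

Lemma star_equiv_sym : symmetric star_equiv.
Proof. by move=> x y; apply/asboolP/asboolP; exact: congr_sym. Qed.

Lemma star_equiv_trans : transitive star_equiv.
Proof.
by move=> y x z /asboolP xy /asboolP yz; apply/asboolP; exact: congr_trans yz.
Qed.

Definition star_equiv_rel :=
  EquivRel star_equiv star_equiv_refl star_equiv_sym star_equiv_trans.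

Definition Osphere : Type := {eq_quot star_equiv_rel}%qT.

HB.instance Definition _ := Choice.on Osphere.

Definition Osphere_pi (t : star_expr) : Osphere :=
  (\pi_({eq_quot star_equiv_rel}) t)%qT.
Definition Osphere_repr (x : Osphere) : star_expr :=
  repr (x : {eq_quot star_equiv_rel}%qT).

Lemma Osphere_reprK x : Osphere_pi (Osphere_repr x) = x.
Proof. exact: reprK. Qed.

Lemma Osphere_piP t u : Osphere_pi t = Osphere_pi u <-> star_congr t u.
Proof.
split=> [/eqmodP/asboolP //|tu]; by apply/eqmodP/asboolP.
Qed.

Lemma Osphere_piK t : star_congr (Osphere_repr (Osphere_pi t)) t.
Proof. by apply/Osphere_piP; rewrite Osphere_reprK. Qed.

Definition Oadd x y := Osphere_pi (Osphere_repr x ⊕ Osphere_repr y).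
Definition Oopp x := Osphere_pi (EOpp (Osphere_repr x)).
Definition Omul x y := Osphere_pi (Osphere_repr x ⊗ Osphere_repr y).
Definition Oscale c x := Osphere_pi (c ⊙ Osphere_repr x).
Definition Ostar x := Osphere_pi (EStar (Osphere_repr x)).

Lemma OaddE t u : Oadd (Osphere_pi t) (Osphere_pi u) = Osphere_pi (t ⊕ u).
Proof. by apply/Osphere_piP/congr_add; exact: Osphere_piK. Qed.
Lemma OoppE t : Oopp (Osphere_pi t) = Osphere_pi (EOpp t).
Proof. by apply/Osphere_piP/congr_opp; exact: Osphere_piK. Qed.
Lemma OmulE t u : Omul (Osphere_pi t) (Osphere_pi u) = Osphere_pi (t ⊗ u).
Proof. by apply/Osphere_piP/congr_mul; exact: Osphere_piK. Qed.
Lemma OscaleE c t : Oscale c (Osphere_pi t) = Osphere_pi (c ⊙ t).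
Proof. by apply/Osphere_piP/congr_scale; exact: Osphere_piK. Qed.
Lemma OstarE t : Ostar (Osphere_pi t) = Osphere_pi (EStar t).
Proof. by apply/Osphere_piP/congr_star; exact: Osphere_piK. Qed.
Definition OE := (OaddE, OoppE, OmulE, OscaleE, OstarE).

Local Ltac lift_congr E :=
  repeat (let x := fresh "x" in move=> x;
          match type of x with
          | Osphere => rewrite -(Osphere_reprK x)
          | _ => idtac
          end);
  rewrite !OE; apply/Osphere_piP; exact: E.

Fact OaddA : associative Oadd. Proof. lift_congr congr_addA. Qed.
Fact OaddC : commutative Oadd. Proof. lift_congr congr_addC. Qed.
Fact Oadd0 : left_id (Osphere_pi EZero) Oadd. Proof. lift_congr congr_add0. Qed.
Fact OaddN : left_inverse (Osphere_pi EZero) Oopp Oadd.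
Proof. lift_congr congr_addN. Qed.

HB.instance Definition _ :=
  GRing.isZmodule.Build Osphere OaddA OaddC Oadd0 OaddN.

Fact OmulA : associative Omul. Proof. lift_congr congr_mulA. Qed.
Fact Omul1l : left_id (Osphere_pi EOne) Omul. Proof. lift_congr congr_mul1l. Qed.
Fact Omul1r : right_id (Osphere_pi EOne) Omul. Proof. lift_congr congr_mul1r. Qed.
Fact OmulDl : left_distributive Omul Oadd. Proof. lift_congr congr_mulDl. Qed.
Fact OmulDr : right_distributive Omul Oadd. Proof. lift_congr congr_mulDr. Qed.

Fact Oone_neq0 : Osphere_pi EOne != 0 :> Osphere.
Proof.
apply/eqP => /Osphere_piP /(@star_eval_congr C^o 1 1) /= H.
have /eqP : (1 : C^o) = 0; last by rewrite oner_eq0.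
have rel1 (r : R) : 1 - r%:C *: (1 : C^o) = (1 - r)%:C *: 1.
  by rewrite rmorphB rmorph1 scalerBl scale1r.
by apply: H; split; rewrite ?star1 ?mulr1 ?subrr ?mul0r.
Qed.

HB.instance Definition _ := GRing.Zmodule_isNzRing.Build Osphere
  OmulA Omul1l Omul1r OmulDl OmulDr Oone_neq0.

Fact OscaleA c d x : Oscale c (Oscale d x) = Oscale (c * d) x.
Proof. by move: x; lift_congr congr_scaleA. Qed.
Fact Oscale1 : left_id 1 Oscale. Proof. lift_congr congr_scale1. Qed.
Fact OscaleDr : right_distributive Oscale Oadd. Proof. lift_congr congr_scaleDr. Qed.
Fact OscaleDl x : {morph Oscale^~ x : c d / c + d >-> Oadd c d}.
Proof. by move: x; lift_congr congr_scaleDl. Qed.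

HB.instance Definition _ := GRing.Zmodule_isLmodule.Build C Osphere
  OscaleA Oscale1 OscaleDr OscaleDl.

Fact OscaleAl c x y : Oscale c (Omul x y) = Omul (Oscale c x) y.
Proof. by move: x y; lift_congr congr_scaleAl. Qed.
Fact OscaleAr c x y : Oscale c (Omul x y) = Omul x (Oscale c y).
Proof. by move: x y; lift_congr congr_scaleAr. Qed.

HB.instance Definition _ :=
  GRing.Lmodule_isLalgebra.Build C Osphere OscaleAl.
HB.instance Definition _ :=
  GRing.Lalgebra_isAlgebra.Build C Osphere OscaleAr.

Fact OstarK : involutive Ostar. Proof. lift_congr congr_starK. Qed.
Fact OstarD : {morph Ostar : x y / Oadd x y}. Proof. lift_congr congr_starD. Qed.
Fact OstarZ c x : Ostar (Oscale c x) = Oscale (Num.conj c) (Ostar x).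
Proof. by move: x; lift_congr congr_starZ. Qed.
Fact OstarM x y : Ostar (Omul x y) = Omul (Ostar y) (Ostar x).
Proof. by move: x y; lift_congr congr_starM. Qed.

HB.instance Definition _ :=
  isStarAlgebra.Build C Osphere OstarK OstarD OstarZ OstarM.

Definition gen_a : Osphere := Osphere_pi EGenA.
Definition gen_b : Osphere := Osphere_pi EGenB.

End Osphere.

Definition star_hom (C : numClosedFieldType) (A B : starAlgType C)
    (f : A -> B) : Prop :=
  [/\ forall x y, f (x + y) = f x + f y,
      forall c x, f (c *: x) = c *: f x,
      forall x y, f (x * y) = f x * f y,
      f 1 = 1
    & forall x, f (star x) = star (f x)].

Section Universal.
Variables (R : realType) (p q : R).
Local Notation O := (Osphere p q).
Local Notation cls := (@Osphere_pi R p q).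

Lemma Osphere_rel : sphere_rel p q (gen_a p q) (gen_b p q).
Proof.
have ES t : star (cls t) = cls (EStar t) by rewrite -OstarE.
have EM t u : cls t * cls u = cls (EMul t u) by rewrite -OmulE.
have EZ c t : c *: cls t = cls (EScale c t) by rewrite -OscaleE.
have EN t : - cls t = cls (EOpp t) by rewrite -OoppE.
have EA t u : cls t + cls u = cls (EAdd t u) by rewrite -OaddE.
have E0 : 0 = cls (EZero R) by [].
have E1 : 1 = cls (EOne R) by [].
split; rewrite /gen_a /gen_b ?E0 ?E1 ?ES
  ?(EM (EGenA R)) ?(EM (EGenB R)) ?(EM (EStar _)) ?EZ ?EN ?EA ?EM;
  apply/Osphere_piP.
- exact: congr_relA.
- exact: congr_relB.
- exact: congr_relAB.
- exact: congr_relSAB.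
- exact: congr_relP.
Qed.

Lemma Osphere_universal (A : starAlgType R[i]) (a b : A) :
  sphere_rel p q a b ->
  exists! f : O -> A,
    [/\ star_hom f, f (gen_a p q) = a & f (gen_b p q) = b].
Proof.
move=> rel.
pose f (x : O) := star_eval a b (Osphere_repr x).
have fE t : f (cls t) = star_eval a b t.
  exact/(star_eval_congr rel)/Osphere_piK.
exists f; split.
  split; [|exact: (fE (EGenA R))|exact: (fE (EGenB R))].
  by split=> [x y|c x|x y||x]; exact: fE.
move=> g [[gD gZ gM g1 gS] ga gb]; apply/funext => x.
rewrite -(Osphere_reprK x) fE.
have g0 : g 0 = 0 by rewrite -(scale0r 0) gZ scale0r.
elim: (Osphere_repr x) => /= [||||t -> u ->|t ->|t -> u ->|c t ->|t ->].
- by rewrite -ga.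
- by rewrite -gb.
- by rewrite -g0.
- by rewrite -g1.
- by rewrite -gD -OaddE.
- by rewrite -scaleN1r -gZ scaleN1r -OoppE.
- by rewrite -gM -OmulE.
- by rewrite -gZ -OscaleE.
- by rewrite -gS -OstarE.
Qed.

End Universal.

(* The inner product is linear in the first variable and conjugate-linear in   *)
(* the second one.                                                             *)
HB.mixin Record isHilbert (R : realType) H of NormedModule R[i] H := {
  inner : {dot H for @Num.conj R[i]};
  inner_norm : forall u : H, `|u| ^+ 2 = inner u u
}.

#[short(type="hilbertType")]
HB.structure Definition Hilbert (R : realType) :=
  {H of isHilbert R H & CompleteNormedModule R[i] H}.

Definition complex_line (R : realType) : Type := R[i]^o.

Section ComplexLine.
Variable R : realType.
Local Notation C := R[i].
Local Notation L := (complex_line R).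

HB.instance Definition _ := NormedModule.copy L C^o.

Fact complex_line_complete (F : set_system L) :
  ProperFilter F -> cauchy F -> cvg F.
Proof.
move=> FF /cauchyP Fc.
have part (f : L -> R) : (forall x y, f (x - y) = f x - f y) ->
    (forall z, `|f z|%:C <= `|z|) -> cvg ((f : L -> R) @ F).
  move=> fB fle; apply: R_complete; apply/cauchyP => e e0.
  have /Fc[x Fx] : (0 : C) < e%:C by rewrite ltcR.
  exists (f x); rewrite nbhs_simpl /=; apply: filterS Fx => y.
  rewrite /ball /= => xy; rewrite -ltcR -fB.
  exact: le_lt_trans (fle _) xy.
have /cvg_ex[r /cvgrPdist_lt Fr] : cvg ((@complex.Re R : L -> R) @ F).
  by apply: part => [[? ?] [? ?]//|z]; exact: normc_ge_Re.
have /cvg_ex[s /cvgrPdist_lt Fs] : cvg ((@complex.Im R : L -> R) @ F).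
  apply: part => [[? ?] [? ?]//|z]; rewrite normc_def lecR -sqrtr_sqr.
  by rewrite ler_wsqrtr // lerDr sqr_ge0.
apply/cvg_ex; exists (r +i* s : L); apply/cvgrPdist_lt => -[e e'].
rewrite ltcE /= => /andP[/eqP -> e0].
have e20 : 0 < e / 2 by rewrite divr_gt0.
near=> z.
have zr : `|r - complex.Re z| < e / 2 by near: z; exact: Fr.
have zs : `|s - complex.Im z| < e / 2 by near: z; exact: Fs.
have -> : (r +i* s : L) - z =
    (r - complex.Re z)%:C + 'i%C * (s - complex.Im z)%:C :> C.
  by rewrite [z in LHS]complexE; simpc.
apply: le_lt_trans (ler_normD _ _) _.
have ni : `|'i%C : C| = 1.
  by rewrite normc_def /= expr0n expr1n add0r sqrtr1.
rewrite normrM ni mul1r !normc_def /= !expr0n !addr0 !sqrtr_sqr -rmorphD /=.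
by rewrite -[_ +i* 0]/(e%:C) ltcR [e]splitr ltrD.
Unshelve. all: by end_near. Qed.

HB.instance Definition _ := Uniform_isComplete.Build L complex_line_complete.

Definition line_inner (x y : L) : C := x * Num.conj y.

Fact line_inner_bilinear : bilinear_for
  (GRing.Scale.Law.clone _ _ ( *%R ) _)
  (GRing.Scale.Law.clone _ _ (@Num.conj C \; *%R ) _) line_inner.
Proof.
split=> [y|x] /= a u v; rewrite /line_inner.
  by rewrite mulrDl -mulrA.
by rewrite rmorphD rmorphM /= mulrDr mulrCA.
Qed.

HB.instance Definition _ := bilinear_isBilinear.Build C L L C
  _ _ line_inner line_inner_bilinear.

Fact line_inner_hermitian x y :
  line_inner x y = (-1) ^+ false * Num.conj (line_inner y x).
Proof. by rewrite mul1r /line_inner rmorphM /= conjCK mulrC. Qed.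

HB.instance Definition _ := isHermitianSesquilinear.Build C L
  false (@Num.conj C) line_inner line_inner_hermitian.

Fact line_inner_gt0 (x : L) : x != 0 -> 0 < line_inner x x.
Proof. by move=> x0; rewrite /line_inner -normCK exprn_gt0 ?normr_gt0. Qed.

HB.instance Definition _ := isDotProduct.Build C L line_inner line_inner_gt0.

Fact line_inner_norm (u : L) : `|u| ^+ 2 = line_inner u u.
Proof. exact: normCK. Qed.

HB.instance Definition _ := isHilbert.Build R L line_inner_norm.

End ComplexLine.

Definition bounded_operator (R : realType) (K : hilbertType R)
    (T : {linear K -> K}) : Prop :=
  exists M : R, forall v, `|T v| <= M%:C * `|v|.

(* A unital *-homomorphism A -> B(K) for a nonzero K; the adjoint of a bounded *)
(* operator T is the S with inner (T u) v = inner u (S v), so rep_star says    *)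
(* that rep (star x) is the adjoint of rep x.                                  *)
Record star_rep (R : realType) (A : starAlgType R[i]) (K : hilbertType R) :=
  StarRep {
  rep :> A -> {linear K -> K};
  rep_nonzero : exists v : K, v != 0;
  rep_bounded : forall x, bounded_operator (rep x);
  repD : forall x y v, rep (x + y) v = rep x v + rep y v;
  repZ : forall c x v, rep (c *: x) v = c *: rep x v;
  repM : forall x y v, rep (x * y) v = rep x (rep y v);
  rep1 : forall v, rep 1 v = v;
  rep_star : forall x u v, inner (rep x u) v = inner u (rep (star x) v)
}.

Definition closed_subspace (R : realType) (K : hilbertType R) (V : set K) :
    Prop :=
  [/\ closed V, V 0 & forall (c : R[i]) u v, V u -> V v -> V (c *: u + v)].

Definition irreducible (R : realType) (A : starAlgType R[i])
    (K : hilbertType R) (rho : star_rep A K) : Prop :=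
  forall V : set K, closed_subspace V -> (forall x v, V v -> V (rho x v)) ->
    V = [set 0] \/ V = setT.

Definition unitarily_equivalent (R : realType) (A : starAlgType R[i])
    (K1 K2 : hilbertType R) (rho1 : star_rep A K1) (rho2 : star_rep A K2) :
    Prop :=
  exists U : {linear K1 -> K2},
    [/\ forall u v, inner (U u) (U v) = inner u v,
        forall w, exists v, U v = w
      & forall x v, U (rho1 x v) = rho2 x (U v)].

Definition orthonormal_basis (R : realType) (H : hilbertType R)
    (e : nat -> H) : Prop :=
  (forall i j, inner (e i) (e j) = (i == j)%:R) /\
  closure [set v | exists n (c : 'I_n -> R[i]), v = \sum_(i < n) c i *: e i]
    = setT.

Definition expi (R : realType) (theta : R) : R[i] := cos theta +i* sin theta.

Section Families.
Variables (R : realType) (p q : R).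
Local Notation O := (Osphere p q).
Local Notation a := (gen_a p q).
Local Notation b := (gen_b p q).

Definition is_rho1 (H : hilbertType R) (e : nat -> H) (theta : R)
    (rho : star_rep O H) : Prop :=
  forall k, rho a (e k) = expi theta *: e k /\
            rho b (e k) = (Num.sqrt (1 - p ^+ k.+1))%:C *: e k.+1.

Definition is_rho2 (H : hilbertType R) (e : nat -> H) (theta : R)
    (rho : star_rep O H) : Prop :=
  forall k, rho a (e k) = (Num.sqrt (1 - q ^+ k.+1))%:C *: e k.+1 /\
            rho b (e k) = expi theta *: e k.

Definition is_rho12 (theta1 theta2 : R) (rho : star_rep O (complex_line R)) :
    Prop :=
  forall z, rho a z = expi theta1 *: z /\ rho b z = expi theta2 *: z.

End Families.

(* Main.v *)
(* Write [A], [B] for the images of the generators in an irreducible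
   representation and put [X = 1 - A A*], [Y = 1 - B B*]. The relations give
   [X A = q A X], [A* X = q X A*], and [X] commutes with [B], [B*], so [ker X]
   is invariant, hence [X] is injective or zero; likewise [Y]. As [X Y = 0],
   [X] or [Y] vanishes.

   If [X <> 0] then [B] is unitary and commutes with everything, so it is a
   scalar of modulus one by Schur's lemma. Since
   [X^n - X^(n+1) = q^n A X^n A*] and [A], [X] are contractions, [X^n v]
   converges, and the limit lies in [ker A*]. If all these limits vanished,
   [A] would have dense range; but then [X <= M <= 1] improves to [X <= q M],
   hence [X <= 0] and [X = 0]. So there is a unit vector [w] with [A* w = 0],
   and the normalised vectors [A^k w] are orthonormal (eigenvectors of [X] for
   the eigenvalues [q^k]) with invariant closed span. If [X = Y = 0], both [A]
   and [B] are scalars and the representation is one-dimensional.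

   Schur's lemma for a self-adjoint [D] commuting with the representation
   needs no spectral theorem: take [D] with [<D w, w> = 0] for some [w <> 0].
   As [(|D| - D)(|D| + D) = 0] and both kernels are invariant, [D] or [-D] is
   positive, so [D w = 0], and the invariant subspace [ker D] is everything. *)

Require Import Defs.
From HB Require Import structures.
From mathcomp Require Import all_boot all_order all_algebra.
From mathcomp Require Import complex.
From mathcomp Require Import all_classical all_reals all_analysis.
From mathcomp Require Import ring lra.

Set Implicit Arguments.
Unset Strict Implicit.
Unset Printing Implicit Defensive.

Import Order.TTheory GRing.Theory Num.Theory.
Import numFieldNormedType.Exports.

Local Open Scope classical_set_scope.
Local Open Scope ring_scope.
Local Open Scope complex_scope.

(** * Hilbert space preliminaries *)

(* The norm and the inner product take values in [R[i]]; their real-valued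
   versions [rnorm] and [rip] give access to real arithmetic. *)
Section HilbertReal.
Variables (R : realType) (H : hilbertType R).
Implicit Types (u v w : H) (c : R[i]).

Definition rnorm u : R := complex.Re `|u|.
Definition rip u v : R := complex.Re (inner u v).

Lemma rnormE u : `|u| = (rnorm u)%:C.
Proof.
by rewrite /rnorm; move: (normr_ge0 u); case: `|u| => a b;
  rewrite lecE /= => /andP[/eqP ->].
Qed.

Lemma rnorm_ge0 u : 0 <= rnorm u.
Proof. by rewrite -lecR -rnormE normr_ge0. Qed.

Lemma rip_rnorm u : rip u u = rnorm u ^+ 2.
Proof. by rewrite /rip -inner_norm rnormE -rmorphXn. Qed.

Lemma inner_rnorm u : inner u u = (rnorm u ^+ 2)%:C.
Proof. by rewrite -inner_norm rnormE -rmorphXn. Qed.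

Lemma rnorm0_eq0 u : rnorm u = 0 -> u = 0.
Proof. by move=> u0; apply/normr0_eq0; rewrite rnormE u0. Qed.

Lemma rnorm_eq0 u : (rnorm u == 0) = (u == 0).
Proof. by rewrite -[u == 0]normr_eq0 rnormE -(inj_eq (@complexI _)). Qed.

Lemma rnorm0 : rnorm 0 = 0.
Proof. by apply/eqP; rewrite rnorm_eq0. Qed.

Lemma rnormN u : rnorm (- u) = rnorm u.
Proof. by rewrite /rnorm normrN. Qed.

Lemma rnormB u v : rnorm (u - v) = rnorm (v - u).
Proof. by rewrite -rnormN opprB. Qed.

Lemma rnormD u v : rnorm (u + v) <= rnorm u + rnorm v.
Proof. by rewrite -lecR rmorphD /= -!rnormE ler_normD. Qed.

Lemma rnormZ c u : rnorm (c *: u) = complex.Re `|c| * rnorm u.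
Proof.
apply/complexI; rewrite rmorphM /= -!rnormE normrZ. congr (_ * _).
Qed.

Lemma rnormZr (x : R) u : rnorm (x%:C *: u) = `|x| * rnorm u.
Proof. by rewrite rnormZ normc_def /= expr0n addr0 sqrtr_sqr. Qed.

Lemma innerC u v : inner u v = Num.conj (inner v u).
Proof. by rewrite hermC mul1r. Qed.

Lemma innerDl u v w : inner (u + v) w = inner u w + inner v w.
Proof. exact: linearDl. Qed.
Lemma innerDr u v w : inner w (u + v) = inner w u + inner w v.
Proof. exact: linearDr. Qed.
Lemma innerBl u v w : inner (u - v) w = inner u w - inner v w.
Proof. exact: linearBl. Qed.
Lemma innerZl c u w : inner (c *: u) w = c * inner u w.
Proof. exact: linearZl_LR. Qed.
Lemma innerZr c u w : inner w (c *: u) = Num.conj c * inner w u.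
Proof. exact: linearZr_LR. Qed.
Lemma inner0l w : inner 0 w = 0.
Proof. exact: linear0l. Qed.
Lemma inner0r w : inner w 0 = 0.
Proof. exact: linear0r. Qed.
Lemma inner_suml n (F : 'I_n -> H) w :
  inner (\sum_(k < n) F k) w = \sum_(k < n) inner (F k) w.
Proof. exact: linear_sumlz. Qed.
Lemma inner_sumr n (F : 'I_n -> H) w :
  inner w (\sum_(k < n) F k) = \sum_(k < n) inner w (F k).
Proof. exact: linear_sumr. Qed.

Lemma ripC u v : rip u v = rip v u.
Proof. by rewrite /rip innerC; case: (inner v u). Qed.

Lemma ripDl u v w : rip (u + v) w = rip u w + rip v w.
Proof. by rewrite /rip innerDl raddfD. Qed.
Lemma ripDr u v w : rip w (u + v) = rip w u + rip w v.
Proof. by rewrite ripC ripDl !(ripC w). Qed.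
Lemma ripNl u w : rip (- u) w = - rip u w.
Proof. by rewrite -[- u]scaleN1r /rip innerZl mulN1r raddfN. Qed.
Lemma ripNr u w : rip w (- u) = - rip w u.
Proof. by rewrite ripC ripNl ripC. Qed.
Lemma ripZl (x : R) u w : rip (x%:C *: u) w = x * rip u w.
Proof. by rewrite /rip innerZl /=; case: (inner u w) => a b /=; ring. Qed.
Lemma ripZr (x : R) u w : rip w (x%:C *: u) = x * rip w u.
Proof. by rewrite ripC ripZl ripC. Qed.
Lemma rip0l u : rip 0 u = 0.
Proof. by rewrite /rip inner0l. Qed.
Lemma rip0r u : rip u 0 = 0.
Proof. by rewrite ripC rip0l. Qed.
Definition ripE := (rip0l, rip0r, ripDl, ripDr, ripNl, ripNr, ripZl, ripZr).

Lemma innerE u v : inner u v = rip u v +i* rip u ('i%C *: v).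
Proof.
rewrite /rip innerZr /=; case: (inner u v) => a b /=.
by congr (_ +i* _); rewrite !(mul0r, mulN1r, opprK, add0r, sub0r).
Qed.

Lemma rip_eq0 u : (forall v, rip u v = 0) -> u = 0.
Proof.
by move=> u0; apply/rnorm0_eq0/eqP; rewrite -sqrf_eq0 -rip_rnorm u0.
Qed.

Lemma rip_inj u v : (forall w, rip u w = rip v w) -> u = v.
Proof.
by move=> uv; apply/subr0_eq/rip_eq0 => w; rewrite ripDl ripNl uv subrr.
Qed.

Lemma inner_inj u v : (forall w, inner u w = inner v w) -> u = v.
Proof. by move=> uv; apply: rip_inj => w; rewrite /rip uv. Qed.

Lemma rip_le u v : `|rip u v| <= rnorm u * rnorm v.
Proof.
rewrite -ler_sqr ?nnegrE ?mulr_ge0 ?rnorm_ge0// real_normK ?num_real//.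
rewrite exprMn -!rip_rnorm.
have [->|v0] := eqVneq v 0; first by rewrite !ripE expr0n mulr0.
have vv : 0 < rip v v by rewrite rip_rnorm exprn_gt0// lt0r rnorm_ge0 rnorm_eq0 v0.
(* Cauchy-Schwarz without division: this is the component of [u] orthogonal to [v] for [rip],
   multiplied by [rip v v]. *)
have : 0 <= rip ((rip v v)%:C *: u - (rip u v)%:C *: v)
                ((rip v v)%:C *: u - (rip u v)%:C *: v).
  by rewrite rip_rnorm sqr_ge0.
rewrite !ripE (ripC v u).
have -> (a b c : R) : a * (a * b - c * c) - c * (a * c - c * a) =
  a * (b * a - c ^+ 2) by ring.
by rewrite pmulr_rge0// subr_ge0.
Qed.

Lemma ripW u v : rip u v <= rnorm u * rnorm v.
Proof. exact: le_trans (ler_norm _) (rip_le u v). Qed.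

Lemma cvg_rnormP (s : nat -> H) u :
  s @ \oo --> u <->
  forall eps, 0 < eps ->
    exists N, forall n, (N <= n)%N -> rnorm (u - s n) < eps.
Proof.
split=> [/cvgrPdist_lt su eps e0|su].
  have /su[N _ NP] : 0 < eps%:C :> R[i] by rewrite ltcR.
  by exists N => n Nn; rewrite -ltcR -rnormE; exact: NP.
(* A positive element of [R[i]] has zero imaginary part, so the radius reduces to a real one. *)
apply/cvgrPdist_lt => -[e e'] /=; rewrite ltcE /= => /andP[/eqP -> /su[N NP]].
by exists N => // n /= Nn; rewrite rnormE -[_ +i* 0]/(e%:C) ltcR; exact: NP.
Qed.

Lemma closure_rnormP (V : set H) u :
  closure V u <-> forall eps, 0 < eps -> exists2 v, V v & rnorm (u - v) < eps.
Proof.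
split=> [clV eps e0|Vu B].
  have [] := clV (ball u eps%:C); first by apply: nbhsx_ballx; rewrite ltcR.
  by move=> v [Vv]; rewrite -ball_normE /ball_ /= rnormE ltcR; exists v.
move=> /nbhs_ballP[[e e'] /=]; rewrite ltcE /= => /andP[/eqP -> /Vu[v Vv uv]].
by move=> /(_ v) Bv; exists v; split=> //; apply: Bv;
  rewrite -ball_normE /ball_ /= rnormE -[_ +i* 0]/(e%:C) ltcR.
Qed.

Lemma rnorm_cauchy (s : nat -> H) :
  (forall eps, 0 < eps -> exists N, forall n, (N <= n)%N ->
     rnorm (s n - s N) < eps) -> exists u, s @ \oo --> u.
Proof.
move=> sC; suff : cvg (s @ \oo) by move=> sc; exists (lim (s @ \oo)).
apply: cauchy_cvg; apply/cauchyP => -[e e'] /=.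
rewrite ltcE /= => /andP[/eqP -> /sC[N NP]].
exists (s N); exists N => // n /= Nn; rewrite -ball_normE /ball_ /=.
by rewrite distrC rnormE -[_ +i* 0]/(e%:C) ltcR; exact: NP.
Qed.

Lemma cvg_rip (s : nat -> H) u v :
  s @ \oo --> u -> (fun n => rip (s n) v) @ \oo --> rip u v.
Proof.
move=> /cvg_rnormP su; apply/cvgrPdist_lt => eps e0.
have v0 : 0 < rnorm v + 1 by rewrite ltr_wpDl// rnorm_ge0.
have /su[N NP] : 0 < eps / (rnorm v + 1) by rewrite divr_gt0.
exists N => // n /= /NP sn; rewrite -ripNl -ripDl.
apply: le_lt_trans (rip_le _ _) _.
move: sn; rewrite ltr_pdivlMr//; apply: le_lt_trans.
by rewrite ler_wpM2l ?rnorm_ge0// lerDl.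
Qed.

Lemma cvg_rnorm (s : nat -> H) u :
  s @ \oo --> u -> (fun n => rnorm (s n)) @ \oo --> rnorm u.
Proof.
move=> /cvg_rnormP su; apply/cvgrPdist_lt => eps e0.
have [N NP] := su _ e0; exists N => // n /= /NP; apply: le_lt_trans.
have := rnormD (u - s n) (s n); have := rnormD (s n - u) u.
rewrite !subrK (rnormB (s n)) => h1 h2.
by rewrite ler_norml; apply/andP; split; lra.
Qed.

Lemma rnorm_le_cvg (s : nat -> H) u (M : R) :
  s @ \oo --> u -> (forall n, rnorm (s n) <= M) -> rnorm u <= M.
Proof.
move=> /cvg_rnorm su sM; rewrite -(cvg_lim _ su)//.
apply: limr_le; first by apply/cvg_ex; exists (rnorm u).
exact: nearW.
Qed.

End HilbertReal.

(** * Bounded linear maps and positive operators *)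

Section BoundedMaps.
Variable (R : realType).
Implicit Types (K H : hilbertType R).

Definition bounded_by K H (T : K -> H) (M : R) :=
  forall v, rnorm (T v) <= M * rnorm v.

Definition bounded_map K H (T : K -> H) := exists2 M, 0 <= M & bounded_by T M.

Lemma bounded_cvg K H (T : {linear K -> H}) (s : nat -> K) u :
  bounded_map T -> s @ \oo --> u -> (fun n => T (s n)) @ \oo --> T u.
Proof.
move=> [M _ TM] /cvg_rnormP su; apply/cvg_rnormP => eps e0.
have [M0|M0] := ltP 0 M; last first.
  exists 0%N => n _; rewrite -linearB; apply: le_lt_trans e0.
  by apply: le_trans (TM _) _; rewrite mulr_le0_ge0// rnorm_ge0.
have /su[N NP] : 0 < eps / M by rewrite divr_gt0.
exists N => n /NP; rewrite ltr_pdivlMr// mulrC => sn.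
by rewrite -linearB; exact: le_lt_trans (TM _) sn.
Qed.

Lemma bounded_ker_closed K H (T : {linear K -> H}) :
  bounded_map T -> closed [set v | T v = 0].
Proof.
move=> [M M0 TM] u /closure_rnormP clu; apply/rnorm0_eq0/le_anti.
rewrite rnorm_ge0 andbT; apply/ler_addgt0Pr => eps e0; rewrite add0r.
have M1 : 0 < M + 1 by rewrite ltr_wpDl.
have [|v /= Tv uv] := clu (eps / (M + 1)); first by rewrite divr_gt0.
have := TM (u - v); rewrite linearB Tv subr0 => /le_trans; apply.
move: uv; rewrite ltr_pdivlMr// => /ltW; apply: le_trans.
by rewrite mulrC ler_wpM2l ?rnorm_ge0// lerDl.
Qed.

Lemma bounded_mapD K H (S T : K -> H) :
  bounded_map S -> bounded_map T -> bounded_map (S \+ T).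
Proof.
move=> [M M0 SM] [N N0 TN]; exists (M + N); first by rewrite addr_ge0.
by move=> v /=; apply: le_trans (rnormD _ _) _; rewrite mulrDl lerD.
Qed.

Lemma bounded_mapZ K H c (T : K -> H) : bounded_map T -> bounded_map (c \*: T).
Proof.
move=> [M M0 TM]; have c0 : 0 <= complex.Re `|c|.
  by rewrite normc_def /= sqrtr_ge0.
exists (complex.Re `|c| * M); first by rewrite mulr_ge0.
by move=> v /=; rewrite rnormZ -mulrA ler_wpM2l.
Qed.

Lemma bounded_mapB K H (S T : K -> H) :
  bounded_map S -> bounded_map T -> bounded_map (S \- T).
Proof.
move=> bS /(bounded_mapZ (-1)) /(bounded_mapD bS)[M M0 MP].
by exists M => // v; have := MP v; rewrite /= scaleN1r.
Qed.

Lemma bounded_map_comp (K1 K2 K3 : hilbertType R) (T : K2 -> K3) (S : K1 -> K2) :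
  bounded_map T -> bounded_map S -> bounded_map (T \o S).
Proof.
move=> [M M0 TM] [N N0 SN]; exists (M * N); first by rewrite mulr_ge0.
by move=> v /=; apply: le_trans (TM _) _; rewrite -mulrA ler_wpM2l.
Qed.

Lemma bounded_map_id K : bounded_map (idfun : K -> K).
Proof. by exists 1 => // v; rewrite mul1r. Qed.

(** The nonnegative form [rip (E v) v] vanishes at [w]; moving from [w] a little in the direction
    [- E w] would make it negative unless [E w = 0]. *)
Lemma psd_eq0 K (E : {linear K -> K}) w :
  (forall u v, rip (E u) v = rip u (E v)) -> (forall v, 0 <= rip (E v) v) ->
  rip (E w) w = 0 -> E w = 0.
Proof.
move=> Esa Epos Ew; apply/rnorm0_eq0/eqP; rewrite -sqrf_eq0 -rip_rnorm.
set a := rip (E w) (E w); set b := rip (E (E w)) (E w).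
have a0 : 0 <= a by rewrite /a rip_rnorm sqr_ge0.
have b0 : 0 <= b by exact: Epos.
(* The form at [w - t E w] equals [t (t b - 2 a)]. This [t] gives [t b <= a], and the denominator is
   positive even when [b = 0]. *)
pose t := a / (b + 1).
have : 0 <= rip (E (w - t%:C *: E w)) (w - t%:C *: E w) by exact: Epos.
have b1 : 0 < b + 1 by lra.
rewrite linearB linearZ_LR /= !ripE Ew (Esa (E w)) -/a -/b.
have -> : 0 - t * a + (- (t * a) - - (t * (t * b))) = t * (t * b - 2 * a) by ring.
have tb : t * b <= a.
  by rewrite /t mulrAC ler_pdivrMr// ler_wpM2l// lerDl.
have [//|/negP an0] := boolP (a == 0).
have ap : 0 < a by rewrite lt0r a0 andbT; apply/negP.
by rewrite pmulr_rge0 ?divr_gt0//; lra.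
Qed.

Lemma bounded_operatorP K (T : {linear K -> K}) :
  bounded_operator T <-> bounded_map T.
Proof.
split=> [[M MP]|[M _ MP]]; last first.
  by exists M => v; rewrite !rnormE -rmorphM lecR.
exists (Num.max 0 M); first by rewrite le_max lexx.
move=> v; apply: (@le_trans _ _ (M * rnorm v)).
  by rewrite -lecR rmorphM /= -!rnormE.
by rewrite ler_wpM2r ?rnorm_ge0// le_max lexx orbT.
Qed.

End BoundedMaps.

(** * Orthonormal sequences and the operators that are diagonal along them *)

Section Orthonormal.
Variable (R : realType).
Implicit Types (K H : hilbertType R).

Definition orthonormal_seq H (g : nat -> H) :=
  forall i j, inner (g i) (g j) = (i == j)%:R.

Definition nsq (z : R[i]) : R := complex.Re z ^+ 2 + complex.Im z ^+ 2.

Lemma nsq_ge0 z : 0 <= nsq z.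
Proof. by rewrite addr_ge0 ?sqr_ge0. Qed.

Lemma nsqE z : z * Num.conj z = (nsq z)%:C.
Proof.
by case: z => a b; apply/eqP; rewrite eq_complex /=; apply/andP; split;
  apply/eqP; rewrite /nsq /=; ring.
Qed.

Lemma nsqZ (x : R) z : nsq (x%:C * z) = x ^+ 2 * nsq z.
Proof. by case: z => a b; rewrite /nsq /=; ring. Qed.

Definition psum H (g : nat -> H) (a : nat -> R[i]) n :=
  \sum_(k < n) a k *: g k.

Lemma psum0 H (g : nat -> H) a : psum g a 0 = 0.
Proof. by rewrite /psum big_ord0. Qed.

Lemma psumS H (g : nat -> H) a n : psum g a n.+1 = psum g a n + a n *: g n.
Proof. by rewrite /psum big_ord_recr. Qed.

Lemma psum_inner H (g : nat -> H) a n j : orthonormal_seq g ->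
  inner (psum g a n) (g j) = if (j < n)%N then a j else 0.
Proof.
move=> og; elim: n => [|n IH]; first by rewrite psum0 inner0l.
rewrite psumS innerDl IH innerZl /= og (ltnS j) [in RHS]leq_eqVlt (eq_sym n).
by case: (ssrnat.ltngtP j n) => [||->] /=; rewrite ?mulr0 ?mulr1 ?addr0 ?add0r.
Qed.

Lemma rnormDsq H (u v : H) : inner u v = 0 ->
  rnorm (u + v) ^+ 2 = rnorm u ^+ 2 + rnorm v ^+ 2.
Proof.
move=> uv; rewrite -!rip_rnorm !ripE (ripC v) /rip uv /=; ring.
Qed.

(** Pythagoras, one term at a time. The Cauchy property of an orthogonal series is thereby read off
    a real series. *)
Lemma psum_dist H (g : nat -> H) a N n : orthonormal_seq g -> (N <= n)%N ->
  rnorm (psum g a n - psum g a N) ^+ 2 =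
  \sum_(k < n) nsq (a k) - \sum_(k < N) nsq (a k).
Proof.
move=> og /subnK <-; elim: (n - N)%N => [|m IH].
  by rewrite add0n !subrr rnorm0 expr0n.
rewrite addSn psumS addrAC big_ord_recr /= [RHS]addrAC -IH rnormDsq; last first.
  rewrite innerZr /= innerBl !psum_inner// ltnn.
  by rewrite ltnNge leq_addl subrr mulr0.
congr (_ + _); rewrite -rip_rnorm /rip innerZl innerZr /= og eqxx mulr1.
by rewrite nsqE.
Qed.

Lemma bessel K (f : nat -> K) n v : orthonormal_seq f ->
  \sum_(k < n) nsq (inner v (f k)) <= rnorm v ^+ 2.
Proof.
move=> of_; pose s := psum f (fun k => inner v (f k)) n.
have vs : inner (v - s) s = 0.
  rewrite {2}/s /psum inner_sumr big1// => k _.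
  by rewrite innerZr /= innerBl /s psum_inner// ltn_ord subrr mulr0.
have := rnormDsq vs; rewrite subrK => ->.
have := psum_dist (fun k => inner v (f k)) of_ (leq0n n).
rewrite psum0 big_ord0 !subr0 => <-.
by rewrite lerDr sqr_ge0.
Qed.

(** Bundles a function obtained by choice or recursion as a linear map; the existential form lets it
    be destructed in the middle of a proof. *)
Lemma linear_pack K H (T : K -> H) :
  linear T -> exists L : {linear K -> H}, L =1 T.
Proof.
move=> Tl; pose mx := GRing.isLinear.Build _ _ _ _ T Tl.
pose L : {linear K -> H} := HB.pack T mx.
by exists L.
Qed.

(** Bessel's inequality bounds the squared coefficients, so the series converges. Suitable [f], [g],
    [c] give the weighted shifts, their adjoints, and the unitary between two bases. *)
Lemma diag_op K H (f : nat -> K) (g : nat -> H) (c : nat -> R) (M : R) :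
  orthonormal_seq f -> orthonormal_seq g ->
  0 <= M -> (forall k, `|c k| <= M) ->
  exists2 T : {linear K -> H}, bounded_by T M &
    forall v, psum g (fun k => (c k)%:C * inner v (f k)) @ \oo --> T v.
Proof.
move=> of_ og M0 cM.
pose s v := psum g (fun k => (c k)%:C * inner v (f k)).
have bnd v n : \sum_(k < n) nsq ((c k)%:C * inner v (f k)) <= (M * rnorm v) ^+ 2.
  rewrite exprMn; apply: le_trans (ler_wpM2l (sqr_ge0 M) (bessel n v of_)).
  rewrite mulr_sumr ler_sum// => k _; rewrite nsqZ ler_wpM2r ?nsq_ge0//.
  by rewrite -[X in X <= _]real_normK ?num_real// lerXn2r ?nnegrE.
have sc v : exists u : H, s v @ \oo --> u.
  pose S n := \sum_(k < n) nsq ((c k)%:C * inner v (f k)).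
  have Snd : nondecreasing_seq S.
    by apply/nondecreasing_seqP => n; rewrite /S big_ord_recr lerDl nsq_ge0.
  have Sc : cvgn S.
    apply: nondecreasing_is_cvgn => //.
    by exists ((M * rnorm v) ^+ 2) => _ [n _ <-]; exact: bnd.
  apply: rnorm_cauchy => eps e0.
  (* [S] measures squared distances between partial sums, hence the tolerance [eps ^+ 2]. *)
  have /cvgrPdist_lt /(_ (eps ^+ 2)) := Sc; rewrite exprn_gt0// => /(_ isT)[N _ NP].
  exists N => n Nn; rewrite -ltr_sqr ?nnegrE ?rnorm_ge0 ?ltW// psum_dist//.
  have := NP N (leqnn _); have := nondecreasing_cvgn_le Snd Sc n.
  rewrite -/(S n) -/(S N) => h1 /ltr_normlW h2.
  by apply: le_lt_trans h2; rewrite lerD2r.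
pose T v := projT1 (cid (sc v)).
have TP v : s v @ \oo --> T v := projT2 (cid (sc v)).
have [L LE] : exists L : {linear K -> H}, L =1 T.
  apply: linear_pack => a u v.
  have : s (a *: u + v) @ \oo --> a *: T u + T v.
    have -> : s (a *: u + v) = (a \*: s u) \+ s v.
      apply/funext => n; rewrite /s /psum /= scaler_sumr -big_split /=.
      apply: eq_bigr => k _.
      by rewrite scalerA -scalerDl innerDl innerZl /=; congr (_ *: _); ring.
    by apply: cvgD; [exact: cvgZl_tmp|].
  by move=> /(cvg_unique _ (TP _)) -> //; exact: norm_hausdorff.
exists L => [v|v]; rewrite LE; last exact: TP.
apply: rnorm_le_cvg (TP v) _ => n.
rewrite -ler_sqr ?nnegrE ?mulr_ge0 ?rnorm_ge0//.
apply: le_trans (bnd v n).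
have := psum_dist (fun k => (c k)%:C * inner v (f k)) og (leq0n n).
by rewrite psum0 big_ord0 !subr0 => ->.
Qed.

Lemma conj_real (x : R) : Num.conj x%:C = x%:C :> R[i].
Proof. by apply/eqP; rewrite eq_complex /= oppr0 !eqxx. Qed.

(** The imaginary part of [inner u v] is [rip u ('i *: v)], so linearity of [T'] carries the real
    identity over to the complex one. *)
Lemma rip_adjoint K H (T : {linear K -> H}) (T' : {linear H -> K}) :
  (forall u v, rip (T u) v = rip u (T' v)) ->
  forall u v, inner (T u) v = inner u (T' v).
Proof. by move=> TT u v; rewrite innerE [RHS]innerE TT TT linearZ. Qed.

(** The partial sums are already adjoint to each other because the coefficients [c] are real; the
    identity passes to the limit. *)
Lemma diag_op_adjoint K H (f : nat -> K) (g : nat -> H) (c : nat -> R)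
    (T : {linear K -> H}) (T' : {linear H -> K}) :
  (forall v, psum g (fun k => (c k)%:C * inner v (f k)) @ \oo --> T v) ->
  (forall v, psum f (fun k => (c k)%:C * inner v (g k)) @ \oo --> T' v) ->
  forall u v, inner (T u) v = inner u (T' v).
Proof.
move=> TP TP'; apply: rip_adjoint => u v.
have h1 := cvg_rip (v := v) (TP u); have h2 := cvg_rip (v := u) (TP' v).
rewrite [RHS]ripC; apply: (cvg_unique (@Rhausdorff R)) h1 _ => /=.
suff <- : (fun n => rip (psum f (fun k => (c k)%:C * inner v (g k)) n) u) =
  (fun n => rip (psum g (fun k => (c k)%:C * inner u (f k)) n) v) by [].
apply/funext => n; rewrite [LHS]ripC /rip; congr complex.Re.
rewrite /psum inner_sumr inner_suml; apply: eq_bigr => k _.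
rewrite innerZl innerZr rmorphM /= conj_real (innerC (g k) v); ring.
Qed.

Lemma diag_op_basis K H (f : nat -> K) (g : nat -> H) (c : nat -> R)
    (T : {linear K -> H}) :
  orthonormal_seq f ->
  (forall v, psum g (fun k => (c k)%:C * inner v (f k)) @ \oo --> T v) ->
  forall k, T (f k) = (c k)%:C *: g k.
Proof.
move=> of_ TP k; apply: cvg_unique (TP (f k)) _; first exact: norm_hausdorff.
apply/cvg_rnormP => eps e0; exists k.+1 => n kn.
rewrite /psum (bigD1 (Ordinal kn)) //= of_ eqxx mulr1 big1 ?addr0 ?subrr ?rnorm0//.
move=> i /negP ik; rewrite of_; case: eqVneq => [ki|].
  by case: ik; apply/eqP/val_inj.
by rewrite mulr0 scale0r.
Qed.

Lemma diag_op_ortho K H (f : nat -> K) (g : nat -> H) (c : nat -> R)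
    (T : {linear K -> H}) v :
  (forall v, psum g (fun k => (c k)%:C * inner v (f k)) @ \oo --> T v) ->
  (forall k, inner v (f k) = 0) -> T v = 0.
Proof.
move=> TP vf; apply: cvg_unique (TP v) _; first exact: norm_hausdorff.
apply/cvg_rnormP => eps e0; exists 0%N => n _.
by rewrite /psum big1 ?subrr ?rnorm0// => i _; rewrite vf mulr0 scale0r.
Qed.

End Orthonormal.

(** * Representations of the generators *)

Section OperatorModel.
Variables (R : realType) (p q : R) (H : hilbertType R).
Variables A A' B B' : {linear H -> H}.
Hypothesis AA' : forall u v, inner (A u) v = inner u (A' v).
Hypothesis BB' : forall u v, inner (B u) v = inner u (B' v).

(* With [s = true] the expression is evaluated to the adjoint operator; this
   handles [EStar] before adjoints are known to exist. *)
Fixpoint op_eval (s : bool) (t : star_expr R) (v : H) : H :=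
  match t with
  | EGenA => if s then A' v else A v
  | EGenB => if s then B' v else B v
  | EZero => 0
  | EOne => v
  | EAdd x y => op_eval s x v + op_eval s y v
  | EOpp x => - op_eval s x v
  | EMul x y => if s then op_eval s y (op_eval s x v)
                else op_eval s x (op_eval s y v)
  | EScale c x => (if s then Num.conj c else c) *: op_eval s x v
  | EStar x => op_eval (~~ s) x v
  end.

Lemma op_eval_linear s t : linear (op_eval s t).
Proof.
elim: t s => [||||x IHx y IHy|x IH|x IHx y IHy|c x IH|x IH] s a u v /=.
- by case: s; rewrite linearP.
- by case: s; rewrite linearP.
- by rewrite scaler0 addr0.
- by [].
- by rewrite IHx IHy scalerDr addrACA.
- by rewrite IH opprD scalerN.
- by case: s; rewrite ?IHx ?IHy ?IHx.
- by rewrite IH scalerDr !scalerA mulrC.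
- exact: IH.
Qed.

Lemma op_eval_adjoint s t u v :
  inner (op_eval s t u) v = inner u (op_eval (~~ s) t v).
Proof.
elim: t s u v => [||||x IHx y IHy|x IH|x IHx y IHy|c x IH|x IH] s u v /=.
- by case: s => //=; rewrite innerC -AA' -innerC.
- by case: s => //=; rewrite innerC -BB' -innerC.
- by rewrite inner0l inner0r.
- by [].
- by rewrite innerDl innerDr IHx IHy.
- by rewrite -[- op_eval _ _ u]scaleN1r -[- op_eval _ _ v]scaleN1r innerZl
    innerZr IH rmorphN1.
- by case: s; rewrite /= ?IHy ?IHx ?IHy.
- by rewrite innerZl innerZr IH; case: s => //=; rewrite conjCK.
- exact: IH.
Qed.

Lemma op_eval_bounded s t :
  bounded_map A -> bounded_map A' -> bounded_map B -> bounded_map B' ->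
  bounded_map (op_eval s t).
Proof.
move=> bA bA' bB bB'.
elim: t s => [||||x IHx y IHy|x IH|x IHx y IHy|c x IH|x IH] s /=.
- by case: s.
- by case: s.
- by exists 0 => // v; rewrite rnorm0 mul0r.
- by exists 1 => // v; rewrite mul1r.
- exact: (bounded_mapD (IHx s) (IHy s)).
- by have [M M0 TM] := IH s; exists M => // v /=; rewrite rnormN.
- by case: s; exact: bounded_map_comp.
- exact: (bounded_mapZ _ (IH s)).
- exact: IH.
Qed.

Hypothesis relA : forall v, A' (A v) - q%:C *: A (A' v) = (1 - q)%:C *: v.
Hypothesis relB : forall v, B' (B v) - p%:C *: B (B' v) = (1 - p)%:C *: v.
Hypothesis relAB : forall v, A (B v) = B (A v).
Hypothesis relSAB : forall v, A' (B v) = B (A' v).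
Hypothesis relP : forall v,
  v - B (B' v) - A (A' (v - B (B' v))) = 0.

Lemma op_eval_congr x y v :
  star_congr p q x y -> op_eval false x v = op_eval false y v.
Proof.
have lD s t u w : op_eval s t (u + w) = op_eval s t u + op_eval s t w.
  by have := op_eval_linear s t 1 u w; rewrite !scale1r.
have lZ s t c u : op_eval s t (c *: u) = c *: op_eval s t u.
  have l0 : op_eval s t 0 = 0.
    by apply: (addrI (op_eval s t 0)); rewrite -lD !addr0.
  by have := op_eval_linear s t c u 0; rewrite !addr0 l0 addr0.
move=> xy; elim: xy v => /= {x y}.
- by [].
- by [].
- by move=> x y z _ IH1 _ IH2 v; rewrite IH1.
- by move=> x x' y y' _ IH1 _ IH2 v; rewrite IH1 IH2.
- by move=> x x' _ IH v; rewrite IH.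
- by move=> x x' y y' _ IH1 _ IH2 v; rewrite IH2 IH1.
- by move=> c x x' _ IH v; rewrite IH.
(* The induction hypothesis concerns the operators, the goal their adjoints; pairing with [w] moves
   one to the other. *)
- move=> x x' _ IH v; apply: inner_inj => w.
  by rewrite !op_eval_adjoint /= IH.
- by move=> x y z v; rewrite addrA.
- by move=> x y v; rewrite addrC.
- by move=> x v; rewrite add0r.
- by move=> x v; rewrite addNr.
- by [].
- by [].
- by [].
- by [].
- by move=> x y z v; rewrite lD.
- by move=> c d x v; rewrite scalerA.
- by move=> x v; rewrite scale1r.
- by move=> c x y v; rewrite scalerDr.
- by move=> c d x v; rewrite scalerDl.
- by [].
- by move=> c x y v; rewrite lZ.
- by [].
- by [].
- by [].
- by [].
- exact: relA.
- exact: relB.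
- exact: relAB.
- exact: relSAB.
- exact: relP.
Qed.

(** Bounded operators with adjoints that satisfy the relations extend to a representation. Each
    class acts through its chosen representative, and [op_eval_congr] makes the choice
    irrelevant. *)
Lemma operator_model :
  (exists v : H, v != 0) ->
  bounded_map A -> bounded_map A' -> bounded_map B -> bounded_map B' ->
  exists rho : star_rep (Osphere p q) H,
    rho (gen_a p q) =1 A /\ rho (gen_b p q) =1 B.
Proof.
move=> H0 bA bA' bB bB'.
pose r (x : Osphere p q) :=
  projT1 (cid (linear_pack (op_eval_linear false (Osphere_repr x)))).
have rE t v : r (Osphere_pi p q t) v = op_eval false t v.
  rewrite /r; case: cid => L /= ->.
  exact/op_eval_congr/Osphere_piK.
have rP (P : Osphere p q -> Prop) :
    (forall t, P (Osphere_pi p q t)) -> forall x, P x.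
  by move=> PP x; rewrite -(Osphere_reprK x).
have rb x : bounded_operator (r x).
  apply/bounded_operatorP.
  have [M M0 MP] := op_eval_bounded false (Osphere_repr x) bA bA' bB bB'.
  by exists M => // v; rewrite -(Osphere_reprK x) rE; exact: MP.
have rD x y v : r (x + y) v = r x v + r y v.
  elim/rP: x => t; elim/rP: y => u.
  by rewrite -[Osphere_pi p q t + _]/(Oadd _ _) OaddE !rE.
have rZ c x v : r (c *: x) v = c *: r x v.
  by elim/rP: x => t; rewrite -[c *: Osphere_pi p q t]/(Oscale _ _) OscaleE !rE.
have rM x y v : r (x * y) v = r x (r y v).
  elim/rP: x => t; elim/rP: y => u.
  by rewrite -[Osphere_pi p q t * _]/(Omul _ _) OmulE !rE.
have r1 v : r 1 v = v by exact: (rE (EOne R)).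
have rS x u v : inner (r x u) v = inner u (r (star x) v).
  elim/rP: x => t.
  by rewrite -[star (Osphere_pi p q t)]/(Ostar _) OstarE !rE op_eval_adjoint.
by exists (StarRep H0 rb rD rZ rM r1 rS); split=> v /=; rewrite rE.
Qed.

End OperatorModel.

(** * Reduction of statements about representations to the generators *)

Section Representations.
Variables (R : realType) (p q : R).
Local Notation O := (Osphere p q).
Local Notation a := (gen_a p q).
Local Notation b := (gen_b p q).

(** Zero and opposites need no case of their own: they are multiples by [0] and [-1]. *)
Lemma Osphere_ind (P : O -> Prop) :
  P a -> P b -> P 1 -> (forall x y, P x -> P y -> P (x + y)) ->
  (forall x y, P x -> P y -> P (x * y)) -> (forall c x, P x -> P (c *: x)) ->
  (forall x, P x -> P (star x)) -> forall x, P x.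
Proof.
move=> Pa Pb P1 PD PM PZ PS x; rewrite -(Osphere_reprK x).
elim: (Osphere_repr x) => [||||t IHt u IHu|t IH|t IHt u IHu|c t IH|t IH] //.
- by have := PZ 0 _ P1; rewrite scale0r.
- by rewrite -OaddE; exact: PD.
- have := PZ (-1) _ IH.
  by rewrite scaleN1r -[- Osphere_pi p q t]/(Oopp _) OoppE.
- by rewrite -OmulE; exact: PM.
- by rewrite -OscaleE; exact: PZ.
- by rewrite -OstarE; exact: PS.
Qed.

Lemma rep_starV (K : hilbertType R) (A : starAlgType R[i])
    (sigma : star_rep A K) x u v :
  inner (sigma (star x) u) v = inner u (sigma x v).
Proof. by rewrite rep_star starK. Qed.

(** Intertwining propagates along sums, products and scalars; for [star] it follows by taking
    adjoints, which uses that [U] is isometric and onto. *)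
Lemma unitarily_equivalent_gen (K1 K2 : hilbertType R) (sigma : star_rep O K1)
    (rho : star_rep O K2) (U : {linear K1 -> K2}) :
  (forall u v, inner (U u) (U v) = inner u v) ->
  (forall w, exists v, U v = w) ->
  (forall v, U (sigma a v) = rho a (U v)) ->
  (forall v, U (sigma b v) = rho b (U v)) ->
  unitarily_equivalent sigma rho.
Proof.
move=> Ui Us Ua Ub; exists U; split=> //.
elim/Osphere_ind => [||||||].
- exact: Ua.
- exact: Ub.
- by move=> v; rewrite !rep1.
- by move=> x y IHx IHy v; rewrite !repD linearD IHx IHy.
- by move=> x y IHx IHy v; rewrite !repM IHx IHy.
- by move=> c x IH v; rewrite !repZ linearZ IH.
- move=> x IH v; apply: inner_inj => w; have [w' <-] := Us w.
  by rewrite Ui !rep_starV -IH Ui.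
Qed.

Lemma invariant_gen (K : hilbertType R) (sigma : star_rep O K) (V : set K) :
  (forall (c : R[i]) u v, V u -> V v -> V (c *: u + v)) -> V 0 ->
  (forall v, V v -> V (sigma a v)) -> (forall v, V v -> V (sigma (star a) v)) ->
  (forall v, V v -> V (sigma b v)) -> (forall v, V v -> V (sigma (star b) v)) ->
  forall x v, V v -> V (sigma x v).
Proof.
move=> VP V0 Va Va' Vb Vb' x v Vv.
(* With [x] and [star x] treated together, the [star] case of the induction merely swaps the two
   halves. *)
suff : (forall v, V v -> V (sigma x v)) /\ (forall v, V v -> V (sigma (star x) v)).
  by case=> + _; exact.
have VD u w : V u -> V w -> V (u + w).
  by move=> Vu Vw; rewrite -[u]scale1r; exact: VP.
have VZ c u : V u -> V (c *: u).
  by move=> Vu; rewrite -[c *: u]addr0; exact: VP.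
elim/Osphere_ind: x {v Vv} => [||||||].
- by split.
- by split.
- by rewrite star1; split => v; rewrite rep1.
- move=> x y [Px Px'] [Py Py']; rewrite starD; split => v Vv.
    by rewrite repD; apply: VD; auto.
  by rewrite repD; apply: VD; auto.
- by move=> x y [Px Px'] [Py Py']; rewrite starM; split => v Vv; rewrite repM; auto.
- by move=> c x [Px Px']; rewrite starZ; split => v Vv; rewrite repZ; auto.
- by move=> x [Px Px']; rewrite starK.
Qed.

End Representations.

(** * Schur's lemma *)

Section SquareRoot.
Variables (R : realType) (K : hilbertType R) (T : {linear K -> K}).
Hypothesis Tsa : forall u v, rip (T u) v = rip u (T v).
Hypothesis T1 : bounded_by T 1.

(* Visser's iteration for [1 - sqrt(T^2)], i.e. the fixed point equation
   [2 Y = (1 - T^2) + Y^2]; its convergence is controlled by the same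
   iteration [rate] for the scalar equation [2 y = 1 + y^2]. *)
Fixpoint visser n (v : K) : K :=
  if n is m.+1 then (2^-1)%:C *: (v - T (T v) + visser m (visser m v)) else 0.

Fixpoint rate n : R := if n is m.+1 then (1 + rate m ^+ 2) / 2 else 0.

Lemma rate_itv n : 0 <= rate n <= 1.
Proof.
elim: n => [|n /andP[h0 h1]] /=; first by rewrite lexx ler01.
have : rate n ^+ 2 <= 1 by rewrite expr_le1.
by have := sqr_ge0 (rate n) => h2 h3; apply/andP; split; lra.
Qed.

Lemma rate_nondecreasing : nondecreasing_seq rate.
Proof.
apply/nondecreasing_seqP => n /=; have := sqr_ge0 (rate n - 1).
by rewrite sqrrB1; lra.
Qed.

Lemma rate_cvg : cvgn rate.
Proof.
apply: nondecreasing_is_cvgn rate_nondecreasing _.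
by exists 1 => _ [n _ <-]; case/andP: (rate_itv n).
Qed.

Lemma visser_linear n : linear (visser n).
Proof.
elim: n => [|n IH] c u v /=; first by rewrite scaler0 addr0.
rewrite !linearP !IH /= scalerA mulrC -scalerA -scalerDr; congr (_ *: _).
by rewrite !scalerDr (addrACA (c *: u)) [LHS]addrACA.
Qed.

Lemma visser_comm n (S : {linear K -> K}) :
  (forall v, T (S v) = S (T v)) -> forall v, visser n (S v) = S (visser n v).
Proof.
move=> TS; elim: n => [|n IH] v /=; first by rewrite linear0.
rewrite !TS !IH linearZ_LR /=; congr (_ *: _).
by rewrite [RHS]linearD linearB.
Qed.

Lemma visserB n u v : visser n (u - v) = visser n u - visser n v.
Proof. by have := visser_linear n (-1) v u; rewrite !scaleN1r !(addrC (- _)). Qed.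

Lemma visser_comm2 m n v : visser m (visser n v) = visser n (visser m v).
Proof.
have [L LE] := linear_pack (visser_linear n).
rewrite -!LE; apply: visser_comm => {}v; rewrite !LE.
by rewrite (visser_comm n (S := T)).
Qed.

(** Expanding the square, the deficit is [2 |T v|^2 - |T (T v)|^2], which is nonnegative for a
    contraction. *)
Lemma rnorm_sub_sq v : rnorm (v - T (T v)) <= rnorm v.
Proof.
have h : rnorm (T (T v)) ^+ 2 <= rnorm (T v) ^+ 2.
  by rewrite lerXn2r ?nnegrE ?rnorm_ge0//; have := T1 (T v); rewrite mul1r.
rewrite -ler_sqr ?nnegrE ?rnorm_ge0// -rip_rnorm !ripE (ripC v) Tsa !rip_rnorm.
by have := sqr_ge0 (rnorm (T v)); lra.
Qed.

Lemma rnorm_half (v : K) : rnorm ((2^-1)%:C *: v) = rnorm v / 2.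
Proof. by rewrite rnormZr ger0_norm ?invr_ge0// mulrC. Qed.

Lemma visser_bound n : bounded_by (visser n) (rate n).
Proof.
elim: n => [|n IH] v /=; first by rewrite rnorm0 mul0r.
rewrite rnorm_half mulrAC ler_pM2r ?invr_gt0//.
apply: le_trans (rnormD _ _) _; rewrite mulrDl mul1r lerD ?rnorm_sub_sq//.
apply: le_trans (IH _) _; rewrite -mulrA ler_wpM2l//.
by case/andP: (rate_itv n).
Qed.

(** The iterates commute, so [Y_m^2 - Y_n^2 = Y_m (Y_m - Y_n) + Y_n (Y_m - Y_n)], in parallel with
    the factorisation of [rate m ^+ 2 - rate n ^+ 2]. *)
Lemma visser_rate n m v : (n <= m)%N ->
  rnorm (visser m v - visser n v) <= (rate m - rate n) * rnorm v.
Proof.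
elim: m n v => [|m IH] [|n] v //.
- by rewrite !subrr rnorm0 mul0r.
- by move=> _; rewrite !subr0; exact: (visser_bound m.+1).
rewrite ltnS => nm /=; rewrite -scalerBr rnorm_half opprD addrACA subrr add0r.
have -> : visser m (visser m v) - visser n (visser n v) =
    visser m (visser m v - visser n v) + visser n (visser m v - visser n v).
  by rewrite !visserB (visser_comm2 n m) addrA subrK.
have /andP[m0 _] := rate_itv m; have /andP[n0 _] := rate_itv n.
have h1 := visser_bound m (visser m v - visser n v).
have h2 := visser_bound n (visser m v - visser n v).
have h3 := rnormD (visser m (visser m v - visser n v))
  (visser n (visser m v - visser n v)).
have : (rate m + rate n) * rnorm (visser m v - visser n v) <=
  (rate m + rate n) * ((rate m - rate n) * rnorm v).
  by rewrite ler_wpM2l ?addr_ge0// IH.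
have -> : (rate m + rate n) * ((rate m - rate n) * rnorm v) =
  (rate m ^+ 2 - rate n ^+ 2) * rnorm v by ring.
by move: h1 h2 h3; lra.
Qed.

Lemma visser_cvg v : exists u : K, (fun n => visser n v) @ \oo --> u.
Proof.
apply: rnorm_cauchy => eps e0.
have v0 : 0 < rnorm v + 1 by rewrite ltr_wpDl// rnorm_ge0.
have /cvgrPdist_lt /(_ (eps / (rnorm v + 1))) := rate_cvg.
rewrite divr_gt0// => /(_ isT)[N _ NP]; exists N => n Nn.
apply: le_lt_trans (visser_rate v Nn) _.
have := NP N (leqnn _); have := nondecreasing_cvgn_le rate_nondecreasing rate_cvg n.
move=> h1 /ltr_normlW; rewrite ltr_pdivlMr// => h2; apply: le_lt_trans h2.
by rewrite ler_pM ?rnorm_ge0 ?lerD2r ?lerDl// subr_ge0 rate_nondecreasing.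
Qed.

(** With [Y] the strong limit of the iteration, take [A = 1 - Y]: the fixed point equation gives
    [A^2 = T^2], the bound [|Y v| <= |v|] gives positivity, and commutation survives the limit. *)
Lemma operator_abs : exists A : {linear K -> K},
  [/\ bounded_map A, forall v, A (A v) = T (T v), forall v, 0 <= rip (A v) v
    & forall S : {linear K -> K}, bounded_map S ->
        (forall v, T (S v) = S (T v)) -> forall v, A (S v) = S (A v)].
Proof.
pose Y v := projT1 (cid (visser_cvg v)).
have YP v : (fun n => visser n v) @ \oo --> Y v := projT2 (cid (visser_cvg v)).
have uniq (s : nat -> K) (u v : K) : s @ \oo --> u -> s @ \oo --> v -> u = v.
  by move=> su sv; apply: cvg_unique su sv; exact: norm_hausdorff.
have Yl : linear Y.
  move=> c u v; apply: uniq (YP _) _.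
  have -> : (fun n => visser n (c *: u + v)) =
      (c \*: (fun n => visser n u)) \+ (fun n => visser n v).
    by apply/funext => n; exact: visser_linear.
  by apply: cvgD => //; exact: cvgZl_tmp.
have Y1 v : rnorm (Y v) <= rnorm v.
  apply: rnorm_le_cvg (YP v) _ => n; apply: le_trans (visser_bound n v) _.
  by rewrite -[leRHS]mul1r ler_wpM2r ?rnorm_ge0//; case/andP: (rate_itv n).
have Yeq v : (2 : R)%:C *: Y v = v - T (T v) + Y (Y v).
  apply: uniq (_ : (fun n => (2 : R)%:C *: visser n.+1 v) @ \oo --> _) _.
    by apply: cvgZl_tmp; have := YP v; rewrite -(cvg_shiftS (fun n => visser n v)).
  have -> : (fun n => (2 : R)%:C *: visser n.+1 v) =
      (fun n => v - T (T v) + visser n (visser n v)).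
    apply/funext => n /=; rewrite scalerA -rmorphM /= divff ?scale1r//.
  apply: cvgD; first exact: cvg_cst.
  apply/cvg_rnormP => eps e0; have e2 : 0 < eps / 2 by rewrite divr_gt0.
  have /cvg_rnormP /(_ _ e2)[N1 P1] := YP v.
  have /cvg_rnormP /(_ _ e2)[N2 P2] := YP (Y v).
  exists (maxn N1 N2) => n; rewrite geq_max => /andP[/P1 h1 /P2 h2].
  (* Both the index and the argument vary; in this splitting the second term is controlled because
     each iterate is a contraction. *)
  have -> : Y (Y v) - visser n (visser n v) =
      (Y (Y v) - visser n (Y v)) + visser n (Y v - visser n v).
    by rewrite visserB addrA subrK.
  apply: le_lt_trans (rnormD _ _) _; rewrite [eps]splitr ltrD//.
  apply: le_lt_trans h1; apply: le_trans (visser_bound n _) _.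
  by rewrite -[leRHS]mul1r ler_wpM2r ?rnorm_ge0//; case/andP: (rate_itv n).
have [L LE] := linear_pack Yl.
exists (idfun \- L : {linear K -> K}); split => /=.
- exists 2 => // v /=; rewrite LE; apply: le_trans (rnormD _ _) _.
  by rewrite rnormN; have := Y1 v; lra.
- move=> v; have := Yeq v; rewrite rmorphD rmorph1 scalerDl scale1r => E.
  rewrite linearB /= !LE opprB addrACA -opprD E (addrAC v (- T (T v))) opprB.
  by rewrite addrC subrK.
- move=> v; rewrite !ripE LE rip_rnorm subr_ge0.
  apply: le_trans (ripW _ _) _.
  by rewrite expr2 ler_wpM2r ?rnorm_ge0.
- move=> S bS TS v; rewrite linearB; congr (_ - _); rewrite !LE.
  apply: uniq (YP _) _.
  have -> : (fun n => visser n (S v)) = (fun n => S (visser n v)).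
    by apply/funext => n; exact: visser_comm.
  exact: bounded_cvg (YP v).
Qed.

End SquareRoot.


Section Schur.
Variables (R : realType) (A : starAlgType R[i]) (K : hilbertType R).
Variables (sigma : star_rep A K) (irr : irreducible sigma).

Lemma rep_bounded_map x : bounded_map (sigma x).
Proof. exact/bounded_operatorP/rep_bounded. Qed.

(** The kernel is a closed invariant subspace. This is how irreducibility enters Schur's lemma and
    the dichotomy for the defects. *)
Lemma ker_irreducible (S : {linear K -> K}) : bounded_map S ->
  (forall x v, S v = 0 -> S (sigma x v) = 0) ->
  (forall v, S v = 0 -> v = 0) \/ (forall v, S v = 0).
Proof.
move=> bS cS; pose V : set K := [set v | S v = 0].
have VP : closed_subspace V.
  split; rewrite /V /=.
  - exact: bounded_ker_closed.
  - exact: linear0.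
  - by move=> c u v Su Sv; rewrite linearP Su Sv scaler0 addr0.
case: (irr VP cS) => [V0|VT]; [left => v Sv|right => v].
  by have : V v by []; rewrite V0.
by have : V v; [rewrite VT|].
Qed.


Lemma schur_selfadjoint (T : {linear K -> K}) : bounded_map T ->
  (forall u v, rip (T u) v = rip u (T v)) ->
  (forall x v, T (sigma x v) = sigma x (T v)) ->
  exists c : R, forall v, T v = c%:C *: v.
Proof.
move=> bT Tsa Tc; have [w w0] := rep_nonzero sigma.
(* The only candidate for the scalar: it makes [D = T - c] satisfy [rip (D w) w = 0]. *)
pose c := rip (T w) w / rnorm w ^+ 2.
have ww : rnorm w != 0 by rewrite rnorm_eq0.
have [D bD DE] : exists2 D : {linear K -> K}, bounded_map D &
    forall v, D v = T v - c%:C *: v.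
  exists (T \- (c%:C \*: idfun)) => //.
  by apply/bounded_mapB/bounded_mapZ/bounded_map_id.
have Dsa u v : rip (D u) v = rip u (D v) by rewrite !DE !ripE Tsa.
have Dw : rip (D w) w = 0.
  by rewrite DE !ripE rip_rnorm /c divfK ?subrr// expf_neq0.
have Dc x v : D (sigma x v) = sigma x (D v).
  by rewrite !DE linearB [sigma x (_ *: _)]linearZ_LR Tc.
have [M M0 DM] := bD.
(* Rescaling makes [S = e D] a contraction, as the construction of the absolute value requires. *)
pose e := (M + 1)^-1; have e0 : 0 < e by rewrite invr_gt0 ltr_wpDl.
have [S bS SE] : exists2 S : {linear K -> K}, bounded_map S &
    forall v, S v = e%:C *: D v.
  by exists (e%:C \*: D) => //; exact: bounded_mapZ.
have S1 : bounded_by S 1.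
  move=> v; rewrite SE rnormZr gtr0_norm// mul1r ler_pdivrMl ?ltr_wpDl//.
  by apply: le_trans (DM v) _; rewrite ler_wpM2r ?rnorm_ge0// lerDl.
have Ssa u v : rip (S u) v = rip u (S v) by rewrite !SE !ripE Dsa.
have Sc x v : S (sigma x v) = sigma x (S v) by rewrite !SE Dc linearZ_LR /=.
have [Q [bQ QQ Q0 Qc]] := operator_abs Ssa S1.
have Qs x v : Q (sigma x v) = sigma x (Q v).
  by apply: Qc => [|u]; [exact: rep_bounded_map|exact: Sc].
have QS v : Q (S v) = S (Q v) by apply: Qc.
(* Once [D] has a sign, [psd_eq0] gives [D w = 0], so the kernel of [D] is nonzero and hence the
   whole space. *)
suff [d d0 Dpos] : exists2 d : R, d != 0 & forall v, 0 <= rip ((d%:C \*: D) v) v.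
  have Ew : D w = 0.
    have : (d%:C \*: D) w = 0.
      apply: psd_eq0 => //= [u v|]; first by rewrite !ripE Dsa.
      by rewrite ripZl Dw mulr0.
    by move/eqP; rewrite /= scaler_eq0 => /orP[/eqP[/eqP]|/eqP//]; rewrite (negPf d0).
  exists c => v; apply/subr0_eq; rewrite -DE.
  have [x u Du|D0|//] := ker_irreducible bD.
    by rewrite Dc Du linear0.
  by move: w0; rewrite (D0 _ Ew) eqxx.
(* [Q] is the absolute value of [S]. If [Q - S] is injective, this forces [S = - Q]; otherwise
   [S = Q]. *)
have QSsa v : (Q \- S) (Q v + S v) = 0.
  rewrite /= [Q (_ + _)]linearD [S (_ + _)]linearD QQ QS.
  by rewrite (addrC (S (Q v))) subrr.
have [|x v /= E0|q0|q0] := @ker_irreducible (Q \- S).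
- exact: bounded_mapB.
- by rewrite Qs Sc -linearB E0 linear0.
- exists (- e); first by rewrite oppr_eq0 gt_eqF.
  move=> v; rewrite /= rmorphN scaleNr -SE.
  by have /eqP := q0 _ (QSsa v); rewrite addrC addr_eq0 => /eqP ->; rewrite opprK.
- exists e; first by rewrite gt_eqF.
  by move=> v; have /= /subr0_eq E := q0 v; rewrite /= -SE -E.
Qed.

Lemma schur x : (forall y v, sigma x (sigma y v) = sigma y (sigma x v)) ->
  exists c : R[i], forall v, sigma x v = c *: v.
Proof.
move=> xc.
have xc' y v : sigma (star x) (sigma y v) = sigma y (sigma (star x) v).
  apply: inner_inj => w.
  by rewrite rep_starV [RHS]rep_star rep_starV rep_star xc.
have sa y : star y = y -> forall u v, rip (sigma y u) v = rip u (sigma y v).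
  by move=> yy u v; rewrite /rip rep_star yy.
have [|y v|c1 E1] := @schur_selfadjoint (sigma (x + star x)) (rep_bounded_map _).
- by apply: sa; rewrite starD starK addrC.
- by rewrite !repD xc xc' linearD.
have [|y v|c2 E2] :=
  @schur_selfadjoint (sigma ('i%C *: (x - star x))) (rep_bounded_map _).
- apply: sa; rewrite starZ starD starN starK.
  have -> : Num.conj 'i%C = - 'i%C :> R[i].
    by apply/eqP; rewrite eq_complex /= oppr0 !eqxx.
  by rewrite scaleNr -scalerN opprB.
- rewrite !repZ -[- star x]scaleN1r !repD !repZ xc xc' [RHS]linearZ_LR /=.
  by rewrite [sigma y (_ + _)]linearD [sigma y (_ *: sigma _ _)]linearZ_LR.
have ii : 'i%C * 'i%C = -1 :> R[i] by rewrite -expr2 sqr_i.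
(* From [2 x = (x + star x) - i (i (x - star x))], where [c1] and [c2] are the scalars of the two
   self-adjoint elements. *)
exists ((2^-1)%:C * (c1%:C - 'i%C * c2%:C)) => v.
have := E1 v; have := E2 v.
rewrite repZ -[- star x]scaleN1r !repD !repZ scaleN1r => e2 e1.
rewrite -scalerA scalerBl -e1 -[('i%C * _) *: v]scalerA -e2 scalerA ii scaleN1r opprK.
rewrite addrACA subrr addr0 -[sigma x v]scale1r -scalerDl scalerA.
rewrite -(rmorph1 (real_complex R)) -rmorphD -rmorphM mulVf ?rmorph1//.
Qed.

End Schur.

(** * The q-oscillator relation *)

Section QOscillator.
Variables (R : realType) (K : hilbertType R) (r : R) (S S' : {linear K -> K}).
Hypothesis r01 : 0 < r < 1.
Hypothesis SS' : forall u v, inner (S u) v = inner u (S' v).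
Hypothesis bS : bounded_map S.
Hypothesis relS : forall v, S' (S v) - r%:C *: S (S' v) = (1 - r)%:C *: v.

Let r0 : 0 < r. Proof. by case/andP: r01. Qed.
Let r1 : r < 1. Proof. by case/andP: r01. Qed.

Lemma cvg_geom0 (c : R) : (fun n => r ^+ n * c) @ \oo --> 0.
Proof.
rewrite -[X in _ --> X](mul0r c); apply: cvgMr_tmp.
by apply: cvg_expr; rewrite gtr0_norm.
Qed.

Lemma le_geom (x y c : R) : (forall n, x <= y + r ^+ n * c) -> x <= y.
Proof.
move=> xy; have yc : (fun n => y + r ^+ n * c) @ \oo --> y.
  rewrite -[X in _ --> X]addr0; apply: cvgD; [exact: cvg_cst|exact: cvg_geom0].
rewrite -(cvg_lim _ yc)//; apply: limr_ge; first by apply/cvg_ex; exists y.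
exact: nearW.
Qed.

Let ripS u v : rip (S u) v = rip u (S' v).
Proof. by rewrite /rip SS'. Qed.

Let ripS' u v : rip (S' u) v = rip u (S v).
Proof. by rewrite ripC -ripS ripC. Qed.

Let S'S v : S' (S v) = r%:C *: S (S' v) + (1 - r)%:C *: v.
Proof. by rewrite -relS addrC subrK. Qed.

Lemma rnormS_sq v : rnorm (S v) ^+ 2 = r * rnorm (S' v) ^+ 2 + (1 - r) * rnorm v ^+ 2.
Proof. by rewrite -!rip_rnorm ripS S'S !ripE ripS' . Qed.

(** By Cauchy-Schwarz [|S' v|^4 = <v, S S' v>^2 <= |v|^2 N |S' v|^2]; then one factor [|S' v|^2]
    cancels. *)
Lemma bounded_adjoint_sq N : 0 <= N ->
  (forall v, rnorm (S v) ^+ 2 <= N * rnorm v ^+ 2) ->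
  forall v, rnorm (S' v) ^+ 2 <= N * rnorm v ^+ 2.
Proof.
move=> N0 SN v; set x := rnorm (S' v) ^+ 2; set y := rnorm v ^+ 2.
have x0 : 0 <= x by exact: sqr_ge0.
have y0 : 0 <= y by exact: sqr_ge0.
have xE : x = rip v (S (S' v)) by rewrite /x -rip_rnorm ripS'.
have : x ^+ 2 <= x * (N * y).
  have -> : x * (N * y) = y * (N * x) by ring.
  apply: le_trans (_ : y * rnorm (S (S' v)) ^+ 2 <= _); last first.
    by rewrite ler_wpM2l// SN.
  rewrite /y -exprMn lerXn2r ?nnegrE ?mulr_ge0 ?rnorm_ge0//.
  by rewrite xE ripW.
rewrite expr2; have [->|x1] := eqVneq x 0; first by rewrite mulr_ge0.
by rewrite ler_pM2l// lt0r x1.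
Qed.

(** A bound [N] for the squared norm passes to the adjoint, and then [rnormS_sq] improves it to
    [r N + 1 - r]. Iteration from the given bound tends to [1]. *)
Lemma rnormS_le v : rnorm (S v) <= rnorm v.
Proof.
have [M M0 SM] := bS.
suff bk k v' : rnorm (S v') ^+ 2 <= (1 + r ^+ k * M ^+ 2) * rnorm v' ^+ 2.
  rewrite -ler_sqr ?nnegrE ?rnorm_ge0//; apply: (@le_geom _ _ (M ^+ 2 * rnorm v ^+ 2)).
  by move=> k; have := bk k v; rewrite mulrDl mul1r -mulrA.
elim: k v' => [|k IH] v'.
  rewrite expr0 mul1r; apply: (@le_trans _ _ ((M * rnorm v') ^+ 2)).
    by rewrite lerXn2r ?nnegrE ?mulr_ge0 ?rnorm_ge0.
  by rewrite exprMn ler_wpM2r ?sqr_ge0// lerDr.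
have N0 : 0 <= 1 + r ^+ k * M ^+ 2.
  by rewrite addr_ge0// mulr_ge0 ?sqr_ge0// exprn_ge0// ltW.
have := ler_wpM2l (ltW r0) (bounded_adjoint_sq N0 IH v').
by rewrite rnormS_sq (exprS r k); lra.
Qed.

Lemma rnormS'_le v : rnorm (S' v) <= rnorm v.
Proof.
rewrite -ler_sqr ?nnegrE ?rnorm_ge0// -[leRHS]mul1r.
apply: bounded_adjoint_sq => // u; rewrite mul1r.
by rewrite lerXn2r ?nnegrE ?rnorm_ge0// rnormS_le.
Qed.

(** The defect [1 - S S'], kept as a variable so that it can be instantiated by the image of
    [1 - s * star s]. *)
Variable X : {linear K -> K}.
Hypothesis XE : forall v, X v = v - S (S' v).

Lemma defectS v : X (S v) = r%:C *: S (X v).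
Proof.
rewrite !XE S'S linearB linearD [S (r%:C *: _)]linearZ_LR.
rewrite [S ((1 - r)%:C *: _)]linearZ_LR rmorphB rmorph1 scalerBl scale1r.
by rewrite scalerBr opprD opprB addrCA (addrC (S v)) subrK addrC.
Qed.

Lemma defectS' v : r%:C *: X (S' v) = S' (X v).
Proof.
rewrite !XE [S' (_ - _)]linearB S'S scalerBr rmorphB rmorph1 scalerBl scale1r.
by rewrite opprD opprB [RHS]addrCA (addrC (S' v)) subrK addrC.
Qed.

Lemma S'S_defect v : S' (S v) = v - r%:C *: X v.
Proof.
by rewrite S'S XE scalerBr rmorphB rmorph1 scalerBl scale1r opprB addrCA.
Qed.

Lemma defect_sa u v : rip (X u) v = rip u (X v).
Proof. by rewrite !XE !ripE ripS -ripS'. Qed.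

Lemma rip_defect v : rip (X v) v = rnorm v ^+ 2 - rnorm (S' v) ^+ 2.
Proof. by rewrite XE !ripE ripS !rip_rnorm. Qed.

Lemma rnorm_defect v : rnorm (X v) <= rnorm v.
Proof.
rewrite -ler_sqr ?nnegrE ?rnorm_ge0// -rip_rnorm XE !ripE (ripC v).
rewrite ripS !rip_rnorm.
have : rnorm (S (S' v)) ^+ 2 <= rnorm (S' v) ^+ 2.
  by rewrite lerXn2r ?nnegrE ?rnorm_ge0// rnormS_le.
by have := sqr_ge0 (rnorm (S' v)); lra.
Qed.

Lemma defect_bounded : bounded_map X.
Proof. by exists 1 => // v; rewrite mul1r rnorm_defect. Qed.

Lemma iter_defectS n v : iter n X (S v) = (r ^+ n)%:C *: S (iter n X v).
Proof.
elim: n => [|n IH] /=; first by rewrite expr0 rmorph1 scale1r.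
by rewrite IH linearZ_LR defectS /= scalerA exprSr rmorphM.
Qed.

Lemma rnorm_iter_defect n v : rnorm (iter n X v) <= rnorm v.
Proof. by elim: n => //= n IH; exact: le_trans (rnorm_defect _) IH. Qed.

Lemma iter_defect_linear n : linear (iter n X).
Proof. by elim: n => [|n IH] c u v //=; rewrite IH linearP. Qed.

Lemma iter_defect_step n v :
  iter n X v - iter n.+1 X v = (r ^+ n)%:C *: S (iter n X (S' v)).
Proof.
have [L LE] := linear_pack (iter_defect_linear n).
by rewrite iterSr -!LE -linearB !LE XE opprB addrC subrK iter_defectS.
Qed.

(** Telescoping of [iter_defect_step], whose terms are at most [r ^+ k * rnorm v]; the geometric sum
    is cleared of its denominator [1 - r]. *)
Lemma iter_defect_cauchy n m v : (n <= m)%N ->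
  (1 - r) * rnorm (iter m X v - iter n X v) <= (r ^+ n - r ^+ m) * rnorm v.
Proof.
move=> /subnK <-; elim: (m - n)%N => [|d IH].
  by rewrite add0n !subrr rnorm0 mulr0 mul0r.
have := rnormD (iter (d + n).+1 X v - iter (d + n) X v)
  (iter (d + n) X v - iter n X v).
rewrite addrA subrK => h1.
have h2 : rnorm (iter (d + n).+1 X v - iter (d + n) X v) <= r ^+ (d + n) * rnorm v.
  rewrite rnormB iter_defect_step rnormZr ger0_norm ?exprn_ge0 ?(ltW r0)//.
  rewrite ler_wpM2l ?exprn_ge0 ?(ltW r0)//.
  apply: le_trans (rnormS_le _) _; apply: le_trans (rnorm_iter_defect _ _) _.
  exact: rnormS'_le.
have r1' : 0 <= 1 - r by rewrite subr_ge0 ltW.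
have := ler_wpM2l r1' h1; have := ler_wpM2l r1' h2.
by rewrite addSn exprS; move: IH; lra.
Qed.

Lemma iter_defect_cvg v : exists u : K, (fun n => iter n X v) @ \oo --> u.
Proof.
apply: rnorm_cauchy => eps e0.
have := cvg_geom0 (rnorm v); move/cvgrPdist_lt => /(_ ((1 - r) * eps)).
have r1' : 0 < 1 - r by rewrite subr_gt0.
rewrite mulr_gt0// => /(_ isT)[N _ NP]; exists N => n Nn.
have := NP N (leqnn _); rewrite sub0r normrN.
move=> /(le_lt_trans (ler_norm _)) h.
rewrite -(ltr_pM2l r1'); apply: le_lt_trans h.
apply: le_trans (iter_defect_cauchy v Nn) _.
by rewrite ler_wpM2r ?rnorm_ge0// gerBl exprn_ge0// ltW.
Qed.

(** The limit is fixed by [X], so [S (S' u) = 0], and pairing with [u] gives [|S' u|^2 = 0]. *)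
Lemma vacuum_of_limit v u : (fun n => iter n X v) @ \oo --> u -> S' u = 0.
Proof.
move=> vu; have : X u = u.
  have h : (fun n => iter n.+1 X v) @ \oo --> u.
    by move: vu; rewrite -(cvg_shiftS (fun n => iter n X v)).
  apply: cvg_unique h; first exact: norm_hausdorff.
  exact: (bounded_cvg defect_bounded vu).
rewrite XE => /eqP; rewrite -subr_eq0 addrAC subrr add0r oppr_eq0 => /eqP E.
by apply/rnorm0_eq0/eqP; rewrite -sqrf_eq0 -rip_rnorm -ripS E ripE.
Qed.

(** Each telescoping increment lies in the range of [S]. When the powers of [X] tend to zero, these
    vectors approximate [v], so the range is dense. *)
Lemma iter_defect_range n v : exists u, v - iter n X v = S u.
Proof.
elim: n => [|n [u E]]; first by exists 0; rewrite subrr linear0.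
exists (u + (r ^+ n)%:C *: iter n X (S' v)).
rewrite linearD linearZ_LR /= -E -iter_defect_step /=.
by rewrite addrA subrK.
Qed.

Lemma vacuum_exists : (exists v, X v != 0) -> exists2 w, w != 0 & S' w = 0.
Proof.
move=> [v0 Xv0]; apply: contrapT => nov.
have lim0 v : (fun n => iter n X v) @ \oo --> (0 : K).
  have [u vu] := iter_defect_cvg v; suff u0 : u = 0 by rewrite -u0.
  apply: contrapT => /eqP un0; apply: nov; exists u => //.
  exact: vacuum_of_limit vu.
(* This is [X <= r ^+ k] as quadratic forms. Letting [k] grow gives [X <= 0], while [S'] being a
   contraction gives [X >= 0], so [X = 0]. *)
suff bk k v : (1 - r ^+ k) * rnorm v ^+ 2 <= rnorm (S' v) ^+ 2.
  have le v : rnorm v ^+ 2 <= rnorm (S' v) ^+ 2.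
    apply: (@le_geom _ _ (rnorm v ^+ 2)) => k.
    by have := bk k v; rewrite mulrBl mul1r lerBlDr.
  have ge v : rnorm (S' v) ^+ 2 <= rnorm v ^+ 2.
    by rewrite lerXn2r ?nnegrE ?rnorm_ge0// rnormS'_le.
  move/eqP: Xv0; apply; apply: psd_eq0 => [|v|]; first exact: defect_sa.
    by rewrite rip_defect subr_ge0.
  by rewrite rip_defect; have := ge v0; have := le v0; lra.
elim: k v => [|k IH] v; first by rewrite expr0 subrr mul0r sqr_ge0.
set M := r ^+ k in IH; rewrite exprS -/M.
have M0 : 0 <= M by rewrite exprn_ge0 ?ltW.
have M1 : M <= 1 by rewrite exprn_ile1 ?ltW.
(* on the range of [S] the inequality [X <= r M] reduces to
   [(1 - r X) (M - X) = (1 - r M) (M - X) + r (M - X)^2 >= 0] *)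
have range u : (1 - r * M) * rnorm (S u) ^+ 2 <= rnorm (S' (S u)) ^+ 2.
  have : 0 <= rnorm (M%:C *: u - X u) ^+ 2 by exact: sqr_ge0.
  rewrite -rip_rnorm !ripE (ripC u) !rip_rnorm => h1.
  have h2 := IH u.
  have rM : 0 <= 1 - r * M by rewrite subr_ge0 mulr_ile1 ?(ltW r0) ?(ltW r1).
  have e1 : rnorm (S' (S u)) ^+ 2 =
      rnorm u ^+ 2 - r * rip (X u) u * 2 + r ^+ 2 * rnorm (X u) ^+ 2.
    by rewrite -rip_rnorm S'S_defect !ripE (ripC u) !rip_rnorm; ring.
  have e2 : rnorm (S u) ^+ 2 = rnorm u ^+ 2 - r * rip (X u) u.
    by rewrite -rip_rnorm ripS S'S_defect !ripE (ripC u) rip_rnorm.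
  have e3 := rip_defect u.
  rewrite e1 e2.
  have h3 := ler_wpM2l (mulr_ge0 (ltW r0) rM) (_ : 0 <= M * rnorm u ^+ 2 - rip (X u) u).
  have h4 := ler_wpM2l (mulr_ge0 (ltW r0) (ltW r0)) h1.
  have : 0 <= M * rnorm u ^+ 2 - rip (X u) u by rewrite e3; lra.
  move/h3; move: h4; rewrite !mulr0.
  set a := rnorm u ^+ 2; set b := rip (X u) u; set c := rnorm (X u) ^+ 2.
  by lra.
(* The inequality holds on the range of [S]; these vectors lie there, and it passes to their limit
   [v]. *)
have yc : (fun n => v - iter n X v) @ \oo --> v.
  rewrite -[X in _ --> X]subr0; apply: cvgB => //; exact: cvg_cst.
have c1 := cvg_rnorm yc.
have bS' : bounded_map S' by exists 1 => // u; rewrite mul1r rnormS'_le.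
have c2 := cvg_rnorm (bounded_cvg bS' yc).
have l1 : (fun n => (1 - r * M) * (rnorm (v - iter n X v) *
    rnorm (v - iter n X v))) @ \oo --> (1 - r * M) * (rnorm v * rnorm v).
  by apply: cvgMl_tmp; exact: cvgM.
have l2 : (fun n => rnorm (S' (v - iter n X v)) * rnorm (S' (v - iter n X v))) @ \oo -->
    rnorm (S' v) * rnorm (S' v) by exact: cvgM.
rewrite !expr2 -(cvg_lim _ l1)// -(cvg_lim _ l2)//.
apply: ler_lim; [exact: cvgP l1|exact: cvgP l2|].
apply: nearW => n /=; rewrite -!expr2.
by have [u ->] := iter_defect_range n v.
Qed.

End QOscillator.

(** * The orthonormal sequence generated by a vacuum vector *)

Section ShiftBasis.
Variables (R : realType) (K : hilbertType R) (r : R) (S S' : {linear K -> K}).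
Hypothesis r01 : 0 < r < 1.
Hypothesis SS' : forall u v, inner (S u) v = inner u (S' v).
Hypothesis relS : forall v, S' (S v) - r%:C *: S (S' v) = (1 - r)%:C *: v.

Definition shift_coef k : R := Num.sqrt (1 - r ^+ k.+1).

Lemma shift_arg_gt0 k : 0 < 1 - r ^+ k.+1.
Proof. by case/andP: r01 => r0 r1; rewrite subr_gt0 exprn_ilt1 ?ltW. Qed.

Lemma shift_coef_gt0 k : 0 < shift_coef k.
Proof. by rewrite sqrtr_gt0 shift_arg_gt0. Qed.

Lemma shift_coef_sq k : shift_coef k ^+ 2 = 1 - r ^+ k.+1.
Proof. by rewrite sqr_sqrtr// ltW// shift_arg_gt0. Qed.

Fixpoint shift_vec (w : K) k : K :=
  if k is j.+1 then (shift_coef j)^-1%:C *: S (shift_vec w j) else w.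

Variable w : K.
Hypothesis S'w : S' w = 0.
Hypothesis w1 : inner w w = 1.
Local Notation f := (shift_vec w).

Lemma shift_vecS k : S (f k) = (shift_coef k)%:C *: f k.+1.
Proof.
by rewrite /= scalerA -rmorphM mulfV ?scale1r// gt_eqF ?shift_coef_gt0.
Qed.

(** The relation turns the eigenvalue [1 - r ^+ k] of [S S'] into
    [r (1 - r ^+ k) + 1 - r = 1 - r ^+ k.+1] for [S' S]; applying [S] makes this the eigenvalue of
    [S S'] at the next vector. *)
Lemma shift_vec_eigen k :
  S (S' (f k)) = (1 - r ^+ k)%:C *: f k /\
  S' (S (f k)) = (1 - r ^+ k.+1)%:C *: f k.
Proof.
have step v j : S (S' v) = (1 - r ^+ j)%:C *: v ->
    S' (S v) = (1 - r ^+ j.+1)%:C *: v.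
  move=> SS'v; have /eqP := relS v; rewrite subr_eq => /eqP ->.
  rewrite SS'v scalerA -rmorphM -scalerDl -rmorphD; congr (_%:C *: _).
  by rewrite exprS; ring.
suff E : S (S' (f k)) = (1 - r ^+ k)%:C *: f k by split=> //; exact: step.
elim: k => [|k IH]; first by rewrite /= S'w linear0 subrr scale0r.
rewrite [f k.+1]/= [S' _]linearZ_LR [S (_ *: _)]linearZ_LR /= (step _ _ IH).
by rewrite [S (_ *: _)]linearZ_LR /= !scalerA mulrC.
Qed.

Lemma shift_vecS' k : S' (f k.+1) = (shift_coef k)%:C *: f k.
Proof.
rewrite /= linearZ_LR /= (shift_vec_eigen k).2.
rewrite scalerA -rmorphM -shift_coef_sq expr2 mulKf// gt_eqF//.
exact: shift_coef_gt0.
Qed.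

(** Norms are carried from one vector to the next by the shift formulas; distinct vectors are
    orthogonal as eigenvectors of the self-adjoint [S S'] for distinct eigenvalues. *)
Lemma shift_vec_orthonormal : orthonormal_seq f.
Proof.
have real_neq0 (x : R) : x != 0 -> x%:C != 0 :> R[i].
  by move=> x0; rewrite -(rmorph0 (real_complex R)) (inj_eq (@complexI _)).
have S'S u v : inner (S' u) v = inner u (S v) by rewrite innerC -SS' -innerC.
have ff k : inner (f k) (f k) = 1.
  elim: k => [//|k IH].
  have ck : (shift_coef k)%:C != 0 :> R[i].
    by rewrite real_neq0// gt_eqF// shift_coef_gt0.
  apply: (mulfI ck); rewrite -innerZl -shift_vecS SS' shift_vecS' innerZr IH.
  by rewrite conj_real.
move=> i j; have [->|ij] := eqVneq i j; first exact: ff.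
have := SS' (S' (f i)) (f j);
  rewrite S'S (shift_vec_eigen i).1 (shift_vec_eigen j).1 innerZl innerZr conj_real.
move/eqP; rewrite -subr_eq0 -mulrBl -rmorphB mulf_eq0.
have -> : 1 - r ^+ i - (1 - r ^+ j) = r ^+ j - r ^+ i by ring.
case/orP => [|/eqP//]; apply: contraTeq => _; rewrite real_neq0// subr_eq0.
case/andP: r01 => r0 r1; apply: contra ij => /eqP.
by move/(ieexprIn r0 (negbT (lt_eqF r1))) => ->.
Qed.

End ShiftBasis.

(** * Closed spans, orthonormal bases and the unitary between two of them *)

Section ClosedSpan.
Variables (R : realType).
Implicit Types (K H : hilbertType R).

Definition fspan K (f : nat -> K) : set K :=
  [set v | exists n (c : 'I_n -> R[i]), v = \sum_(i < n) c i *: f i].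

(** Coefficients are padded with zeros, so that two combinations can be written with the same number
    of terms. *)
Lemma fspanP K (f : nat -> K) v :
  fspan f v <-> exists N (c : nat -> R[i]), forall n, (N <= n)%N -> v = psum f c n.
Proof.
split=> [[n [c ->]]|[N [c /(_ N (leqnn _)) ->]]]; last by exists N, (fun i => c i).
pose d k := if insub k is Some i then c i else 0.
exists n, d => m /subnKC <-; rewrite /psum big_split_ord /= [X in _ + X]big1 ?addr0.
  apply: eq_bigr => i _; rewrite /d insubT//= => H; congr (c _ *: _).
  exact: val_inj.
by move=> i _; rewrite /d insubF ?scale0r// ltnNge leq_addr.
Qed.

Lemma fspanZD K (f : nat -> K) c u v :
  fspan f u -> fspan f v -> fspan f (c *: u + v).
Proof.
move=> /fspanP[N [a aP]] /fspanP[M [b bP]]; apply/fspanP.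
exists (maxn N M), (fun k => c * a k + b k) => n.
rewrite geq_max => /andP[/aP -> /bP ->].
rewrite /psum scaler_sumr -big_split /=; apply: eq_bigr => i _.
by rewrite scalerDl scalerA.
Qed.

Lemma fspan0 K (f : nat -> K) : fspan f 0.
Proof. by exists 0%N, (fun=> 0); rewrite big_ord0. Qed.

Lemma fspan_mem K (f : nat -> K) k : fspan f (f k).
Proof.
exists k.+1, (fun i : 'I_k.+1 => (i == ord_max)%:R).
rewrite (bigD1 ord_max)//= eqxx scale1r big1 ?addr0//.
by move=> i /negPf ->; rewrite scale0r.
Qed.

Lemma fspan_stable K (f : nat -> K) (T : {linear K -> K}) :
  (forall k, fspan f (T (f k))) -> forall v, fspan f v -> fspan f (T v).
Proof.
move=> Tf _ [n [c ->]]; rewrite linear_sum; elim/big_rec: _ => [|i v _ IH].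
  exact: fspan0.
by rewrite linearZ_LR; exact: fspanZD.
Qed.

Lemma closure_stable K (V : set K) (T : {linear K -> K}) : bounded_map T ->
  (forall v, V v -> V (T v)) -> forall v, closure V v -> closure V (T v).
Proof.
move=> [M M0 TM] VT v /closure_rnormP clv; apply/closure_rnormP => eps e0.
have M1 : 0 < M + 1 by rewrite ltr_wpDl.
have [|u Vu uv] := clv (eps / (M + 1)); first by rewrite divr_gt0.
exists (T u); first exact: VT.
rewrite -linearB; apply: le_lt_trans (TM _) _.
move: uv; rewrite ltr_pdivlMr//; apply: le_lt_trans.
by rewrite mulrC ler_wpM2l ?rnorm_ge0// lerDl.
Qed.

Lemma closure_fspan_subspace K (f : nat -> K) : closed_subspace (closure (fspan f)).
Proof.
split; first exact: closed_closure.
  by apply: subset_closure; exact: fspan0.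
move=> c u v /closure_rnormP clu /closure_rnormP clv; apply/closure_rnormP => eps e0.
set d := complex.Re `|c|; have d0 : 0 <= d by rewrite /d normc_def /= sqrtr_ge0.
have d1 : 0 < d + 1 by rewrite ltr_wpDl.
have [|u' Vu' uu] := clu (eps / 2 / (d + 1)); first by rewrite !divr_gt0.
have [|v' Vv' vv] := clv (eps / 2); first by rewrite divr_gt0.
exists (c *: u' + v'); first exact: fspanZD.
rewrite opprD addrACA -scalerBr [eps]splitr; apply: le_lt_trans (rnormD _ _) _.
rewrite ltrD// rnormZ -/d; move: uu; rewrite ltr_pdivlMr//; apply: le_lt_trans.
by rewrite mulrC ler_wpM2l ?rnorm_ge0// lerDl.
Qed.

Lemma basis_ext K H (e : nat -> K) (T1 T2 : {linear K -> H}) :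
  orthonormal_basis e -> bounded_map T1 -> bounded_map T2 ->
  (forall k, T1 (e k) = T2 (e k)) -> T1 =1 T2.
Proof.
move=> [_ ecl] b1 b2 E v; apply/subr0_eq.
have cl : closed [set v | (T1 \- T2) v = 0] by exact/bounded_ker_closed/bounded_mapB.
have : closure (fspan e) v by rewrite /fspan ecl.
move: v; suff : closure (fspan e) `<=` [set v | (T1 \- T2) v = 0] by [].
apply: subset_trans cl; apply: closure_subset => _ [n [c ->]] /=.
rewrite [T1 _]linear_sum [T2 _]linear_sum -sumrB big1// => i _.
by rewrite [T1 _]linearZ_LR [T2 _]linearZ_LR E subrr.
Qed.

(** The diagonal operators with all coefficients [1] in the two directions are adjoint, and they are
    mutually inverse because they are so on the bases. *)
Lemma basis_unitary K H (f : nat -> K) (e : nat -> H) :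
  orthonormal_basis f -> orthonormal_basis e -> exists U : {linear K -> H},
  [/\ bounded_map U, forall u v, inner (U u) (U v) = inner u v,
      forall v, exists u, U u = v & forall k, U (f k) = e k].
Proof.
move=> hf he; have [of_ _] := hf; have [oe _] := he.
have c1 : forall k : nat, `|1 : R| <= 1 by rewrite normr1.
have [U bU UP] := diag_op of_ oe ler01 c1.
have [V bV VP] := diag_op oe of_ ler01 c1.
have Uf k : U (f k) = e k by rewrite (diag_op_basis of_ UP) scale1r.
have Ve k : V (e k) = f k by rewrite (diag_op_basis oe VP) scale1r.
have bU' : bounded_map U by exists 1.
have bV' : bounded_map V by exists 1.
have VU : (V \o U) =1 idfun.
  apply: (basis_ext hf); [|exact: bounded_map_id|by move=> k /=; rewrite Uf Ve].
  exists 1 => // v /=; apply: le_trans (bV _) _; rewrite mul1r; exact: bU.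
have UV : (U \o V) =1 idfun.
  apply: (basis_ext he); [|exact: bounded_map_id|by move=> k /=; rewrite Ve Uf].
  exists 1 => // v /=; apply: le_trans (bU _) _; rewrite mul1r; exact: bV.
exists U; split=> // [u v|v].
  by rewrite (diag_op_adjoint UP VP) [V (U v)]VU.
by exists (V v); exact: UV.
Qed.

End ClosedSpan.

(** * The weighted shift on a given basis *)

Section ShiftModel.
Variables (R : realType) (H : hilbertType R) (e : nat -> H) (r : R).
Hypotheses (r01 : 0 < r < 1) (he : orthonormal_basis e).

Lemma shift_model : exists S S' : {linear H -> H},
  [/\ bounded_map S, bounded_map S', forall u v, inner (S u) v = inner u (S' v),
      forall v, S' (S v) - r%:C *: S (S' v) = (1 - r)%:C *: v
    & forall k, S (e k) = (shift_coef r k)%:C *: e k.+1].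
Proof.
have [oe _] := he; have [r0 r1] := andP r01.
have oe1 : orthonormal_seq (e \o succn) by move=> i j /=; rewrite oe eqSS.
have cle k : `|shift_coef r k| <= 1.
  rewrite gtr0_norm ?shift_coef_gt0// -sqrtr1 ler_sqrt// gerBl exprn_ge0// ltW//.
have [S bS SP] := diag_op oe oe1 ler01 cle.
have [S' bS' SP'] := diag_op oe1 oe ler01 cle.
have Se k : S (e k) = (shift_coef r k)%:C *: e k.+1 by exact: diag_op_basis oe SP k.
have S'e k : S' (e k.+1) = (shift_coef r k)%:C *: e k by exact: diag_op_basis oe1 SP' k.
(* [S'] only sees the vectors [e k.+1]. This agrees with the eigenvalue [1 - r ^+ 0 = 0] of [S S']
   at [e 0]. *)
have S'e0 : S' (e 0%N) = 0 by apply: diag_op_ortho SP' _ => k /=; rewrite oe.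
have bSm : bounded_map S by exists 1.
have bSm' : bounded_map S' by exists 1.
exists S, S'; split => //; first exact: diag_op_adjoint SP SP'.
have S'Se k : S' (S (e k)) = (1 - r ^+ k.+1)%:C *: e k.
  by rewrite Se linearZ_LR /= S'e scalerA -rmorphM -expr2 shift_coef_sq.
have SS'e k : S (S' (e k)) = (1 - r ^+ k)%:C *: e k.
  case: k => [|k]; first by rewrite S'e0 linear0 subrr scale0r.
  by rewrite S'e linearZ_LR /= Se scalerA -rmorphM -expr2 shift_coef_sq.
apply: (@basis_ext _ _ _ e ((S' \o S) \- r%:C \*: (S \o S'))
  ((1 - r)%:C \*: idfun)) => //.
- by apply: bounded_mapB; [|apply: bounded_mapZ]; exact: bounded_map_comp.
- by apply: bounded_mapZ; exact: bounded_map_id.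
- move=> k /=; rewrite S'Se SS'e scalerA -rmorphM -scalerBl -rmorphB.
  by congr (_%:C *: _); rewrite exprS; ring.
Qed.

End ShiftModel.

(** * Classification *)

Section UnitCircle.
Variable R : realType.

Lemma nsq_expi (t : R) : nsq (expi t) = 1.
Proof. exact: cos2Dsin2. Qed.

Lemma expi_surj (c : R[i]) : nsq c = 1 ->
  exists2 t : R, 0 <= t < 2 * pi & c = expi t.
Proof.
case: c => x y; rewrite /nsq /expi /= => xy1.
have x2 : x ^+ 2 <= 1 by rewrite -xy1 lerDl sqr_ge0.
have x1 : -1 <= x <= 1.
  by rewrite -ler_norml -(expr_le1 (n := 2))// real_normK ?num_real.
have yE : 1 - x ^+ 2 = y ^+ 2 by rewrite -xy1 addrC addKr.
have pi0 : 0 < (pi : R) := pi_gt0 R.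
have [y0|y0] := leP 0 y.
  exists (acos x).
    by rewrite acos_ge0//=; have := acos_lepi x1; lra.
  by rewrite acosK ?in_itv// sin_acos// yE sqrtr_sqr ger0_norm.
(* On the lower half circle the angle is [2 pi - acos x]; it stays below [2 pi] because [y < 0]
   excludes [x = 1]. *)
have ac0 : 0 < acos x.
  apply: acos_gt0; case/andP: x1 => -> h; rewrite lt_neqAle h andbT /=.
  apply: contraTneq y0 => x1; move: yE; rewrite x1 expr1n subrr => /eqP.
  by rewrite eq_sym sqrf_eq0 => /eqP ->; rewrite ltxx.
exists (2 * pi - acos x).
  by have h := acos_lepi x1; apply/andP; split; lra.
rewrite mulr_natl cosB sinB cos2pi sin2pi acosK ?in_itv// sin_acos// yE sqrtr_sqr.
by rewrite ltr0_norm// !mul1r !mul0r addr0 sub0r opprK.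
Qed.

End UnitCircle.

Lemma normalize (R : realType) (K : hilbertType R) (w : K) : w != 0 ->
  exists c : R[i], inner (c *: w) (c *: w) = 1.
Proof.
move=> w0; exists (rnorm w)^-1%:C.
rewrite innerZl innerZr conj_real inner_rnorm -!rmorphM /=.
by rewrite mulrA -expr2 exprVn mulVf ?rmorph1// expf_neq0 ?rnorm_eq0.
Qed.

(** * Existence of the three families *)

Section Models.
Variables (R : realType) (p q : R).
Hypotheses (p01 : 0 < p < 1) (q01 : 0 < q < 1).

Lemma scalar_adjoint (H : hilbertType R) (c : R[i]) (u v : H) :
  inner ((c \*: idfun) u) v = inner u ((Num.conj c \*: idfun) v).
Proof. by rewrite /= innerZl innerZr conjCK. Qed.

Lemma expi_conj (t : R) : expi t * Num.conj (expi t) = 1.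
Proof. by rewrite nsqE nsq_expi. Qed.

Lemma scalar_unitary (H : hilbertType R) (t : R) (v : H) :
  expi t *: (Num.conj (expi t) *: v) = v.
Proof. by rewrite scalerA expi_conj scale1r. Qed.

Lemma scalar_unitary' (H : hilbertType R) (t : R) (v : H) :
  Num.conj (expi t) *: (expi t *: v) = v.
Proof. by rewrite scalerA mulrC expi_conj scale1r. Qed.

Lemma scalar_bounded (H : hilbertType R) (c : R[i]) :
  bounded_map (c \*: idfun : H -> H).
Proof. exact/bounded_mapZ/bounded_map_id. Qed.

Lemma basis_neq0 (H : hilbertType R) (e : nat -> H) :
  orthonormal_basis e -> exists v : H, v != 0.
Proof.
move=> [oe _]; exists (e 0%N); apply/eqP => e0.
by have /eqP := oe 0%N 0%N; rewrite e0 inner0l eq_sym oner_eq0.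
Qed.

Lemma one_sub_rel (H : hilbertType R) (r : R) (v : H) :
  v - r%:C *: v = (1 - r)%:C *: v.
Proof. by rewrite rmorphB rmorph1 scalerBl scale1r. Qed.

(** The scalar unitary commutes with the shift and has zero defect, so only the shift relation has
    content. *)
Lemma rho1_exists (H : hilbertType R) (e : nat -> H) (t : R) :
  orthonormal_basis e ->
  exists rho : star_rep (Osphere p q) H, is_rho1 e t rho.
Proof.
move=> he; have [S [S' [bS bS' SS' rS Se]]] := shift_model p01 he.
have [||||||||||rho [ra rb]] := @operator_model R p q H (expi t \*: idfun)
  (Num.conj (expi t) \*: idfun) S S' (@scalar_adjoint _ _) SS'.
all: rewrite /=.
- by move=> v; rewrite scalar_unitary scalar_unitary' one_sub_rel.
- exact: rS.
- by move=> v; rewrite linearZ_LR.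
- by move=> v; rewrite linearZ_LR.
- by move=> v; rewrite scalar_unitary subrr.
- exact: basis_neq0 he.
- exact: scalar_bounded.
- exact: scalar_bounded.
- by [].
- by [].
by exists rho => k; rewrite ra rb Se.
Qed.

Lemma rho2_exists (H : hilbertType R) (e : nat -> H) (t : R) :
  orthonormal_basis e ->
  exists rho : star_rep (Osphere p q) H, is_rho2 e t rho.
Proof.
move=> he; have [S [S' [bS bS' SS' rS Se]]] := shift_model q01 he.
have [||||||||||rho [ra rb]] := @operator_model R p q H S S'
  (expi t \*: idfun) (Num.conj (expi t) \*: idfun) SS' (@scalar_adjoint _ _).
all: rewrite /=.
- exact: rS.
- by move=> v; rewrite scalar_unitary scalar_unitary' one_sub_rel.
- by move=> v; rewrite linearZ_LR.
- by move=> v; rewrite linearZ_LR.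
- by move=> v; rewrite scalar_unitary subrr !linear0 addr0.
- exact: basis_neq0 he.
- by [].
- by [].
- exact: scalar_bounded.
- exact: scalar_bounded.
by exists rho => k; rewrite ra rb Se.
Qed.

Lemma rho12_exists (t1 t2 : R) :
  exists rho : star_rep (Osphere p q) (complex_line R), is_rho12 t1 t2 rho.
Proof.
have [||||||||||rho [ra rb]] := @operator_model R p q (complex_line R)
  (expi t1 \*: idfun) (Num.conj (expi t1) \*: idfun)
  (expi t2 \*: idfun) (Num.conj (expi t2) \*: idfun)
  (@scalar_adjoint _ _) (@scalar_adjoint _ _).
all: rewrite /=.
- by move=> v; rewrite scalar_unitary scalar_unitary' one_sub_rel.
- by move=> v; rewrite scalar_unitary scalar_unitary' one_sub_rel.
- by move=> v; rewrite !scalerA mulrC.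
- by move=> v; rewrite !scalerA mulrC.
- by move=> v; rewrite !scalar_unitary subrr.
- by exists ((1 : R[i]) : complex_line R); exact: oner_neq0.
- exact: scalar_bounded.
- exact: scalar_bounded.
- exact: scalar_bounded.
- exact: scalar_bounded.
by exists rho => z; rewrite ra rb.
Qed.

End Models.

(** * Structure of an irreducible representation *)

Section Classification.
Variables (R : realType) (p q : R) (K : hilbertType R).
Local Notation O := (Osphere p q).
Local Notation a := (gen_a p q).
Local Notation b := (gen_b p q).
Variable sigma : star_rep O K.
Hypothesis irr : irreducible sigma.

Lemma rep_comm_star x y :
  (forall v, sigma x (sigma y v) = sigma y (sigma x v)) ->
  forall v, sigma (star x) (sigma (star y) v) = sigma (star y) (sigma (star x) v).
Proof. by move=> xy v; apply: inner_inj => w; rewrite !rep_starV xy. Qed.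

(* The two generators play symmetric roles: [s] is the one represented by a
   shift and [u] the unitary one. *)
Variables s u : O.
Hypothesis su_gen : (s = a /\ u = b) \/ (s = b /\ u = a).

Lemma gen_stable (V : set K) :
  (forall (c : R[i]) v w, V v -> V w -> V (c *: v + w)) -> V 0 ->
  (forall v, V v -> V (sigma s v)) -> (forall v, V v -> V (sigma (star s) v)) ->
  (forall v, V v -> V (sigma u v)) -> (forall v, V v -> V (sigma (star u) v)) ->
  forall x v, V v -> V (sigma x v).
Proof.
by case: su_gen => -[-> ->] VP V0 *; apply: invariant_gen.
Qed.

Lemma gen_comm (x : O) :
  (forall v, sigma x (sigma s v) = sigma s (sigma x v)) ->
  (forall v, sigma x (sigma (star s) v) = sigma (star s) (sigma x v)) ->
  (forall v, sigma x (sigma u v) = sigma u (sigma x v)) ->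
  (forall v, sigma x (sigma (star u) v) = sigma (star u) (sigma x v)) ->
  forall y v, sigma x (sigma y v) = sigma y (sigma x v).
Proof.
move=> xs xs' xu xu' y.
pose P y := forall v, sigma x (sigma y v) = sigma y (sigma x v).
suff : P y /\ P (star y) by case.
elim/Osphere_ind: y => [||||||].
- by case: su_gen xs xs' xu xu' => -[-> ->].
- by case: su_gen xs xs' xu xu' => -[-> ->].
- by rewrite star1; split=> v; rewrite !rep1.
- by move=> y z [Py Py'] [Pz Pz']; rewrite starD; split=> v;
    rewrite !repD linearD ?Py ?Pz ?Py' ?Pz'.
- by move=> y z [Py Py'] [Pz Pz']; rewrite starM; split=> v;
    rewrite !repM ?Py ?Pz ?Pz' ?Py'.
- by move=> c y [Py Py']; rewrite starZ; split=> v;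
    rewrite !repZ linearZ_LR ?Py ?Py'.
- by move=> y [Py Py']; rewrite starK.
Qed.

(** Schur's lemma gives a scalar, the isometry condition its modulus one, and the adjoint relation
    the value at [star x]. *)
Lemma central_unitary (x : O) :
  (forall y v, sigma x (sigma y v) = sigma y (sigma x v)) ->
  (forall v, sigma (star x) (sigma x v) = v) ->
  exists2 t : R, 0 <= t < 2 * pi & forall v,
    sigma x v = expi t *: v /\ sigma (star x) v = Num.conj (expi t) *: v.
Proof.
move=> xc xx; have [c cE] := schur irr xc.
have [w w0] := rep_nonzero sigma.
have c1 : nsq c = 1.
  have := rep_star sigma x w (sigma x w); rewrite xx !cE innerZl innerZr mulrA.
  rewrite nsqE inner_rnorm -rmorphM => /complexI /eqP.
  by rewrite -[X in _ == X]mul1r (inj_eq (mulIf _)) ?expf_neq0 ?rnorm_eq0// => /eqP.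
have [t t2 ct] := expi_surj c1; exists t => // v; rewrite -ct; split=> //.
by apply: inner_inj => w'; rewrite rep_starV cE innerZl innerZr.
Qed.

(** When the generators are scalars every closed subspace is invariant. The line through [w] is such
    a subspace, being the kernel of [v - inner v w *: w], and it is nonzero. *)
Lemma scalar_line :
  (forall x, x \in [:: s; star s; u; star u] ->
     exists c : R[i], forall v, sigma x v = c *: v) ->
  exists2 w : K, inner w w = 1 & forall v, v = inner v w *: w.
Proof.
move=> sc; have [w0 w0n0] := rep_nonzero sigma.
have [c w1] := normalize w0n0; set w := c *: w0 in w1.
exists w => //; move: w1; move: w => {c w0 w0n0} w w1.
have [P PE] : exists P : {linear K -> K}, forall v, P v = v - inner v w *: w.
  have [|P PE] := @linear_pack R K K (fun v : K => v - inner v w *: w);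
    last by exists P.
  move=> c v1 v2; rewrite innerDl innerZl scalerDl opprD addrACA scalerBr.
  by rewrite scalerA.
have bP : bounded_map P.
  exists 1 => // v; rewrite mul1r -ler_sqr ?nnegrE ?rnorm_ge0//.
  have Pw : inner (P v) (inner v w *: w) = 0.
    by rewrite innerZr PE innerBl innerZl w1 mulr1 subrr mulr0.
  by have := rnormDsq Pw; rewrite {1}PE subrK => ->; rewrite lerDl sqr_ge0.
have cV : closed_subspace [set v | P v = 0].
  split; [exact: bounded_ker_closed|exact: linear0|].
  by move=> c v1 v2 /= P1 P2; rewrite linearP P1 P2 scaler0 addr0.
have Psc x : x \in [:: s; star s; u; star u] ->
    forall v, P v = 0 -> P (sigma x v) = 0.
  by move=> /sc[c cE] v Pv; rewrite cE linearZ_LR Pv scaler0.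
have [|P0|PT] := irr cV.
- apply: gen_stable => [c v1 v2 /= P1 P2||||| ].
  + by rewrite linearP P1 P2 scaler0 addr0.
  + exact: linear0.
  + by apply: Psc; rewrite !inE eqxx.
  + by apply: Psc; rewrite !inE eqxx orbT.
  + by apply: Psc; rewrite !inE eqxx !orbT.
  + by apply: Psc; rewrite !inE eqxx !orbT.
- have : [set v | P v = 0] w by rewrite /= PE w1 scale1r subrr.
  by rewrite P0 /= => w00; move/eqP: w1; rewrite w00 inner0l eq_sym oner_eq0.
- move=> v; have : [set v | P v = 0] v by rewrite PT.
  by rewrite /= PE => /subr0_eq.
Qed.

Variable r : R.
Hypothesis r01 : 0 < r < 1.
Hypothesis relS : forall v, sigma (star s) (sigma s v) -
  r%:C *: sigma s (sigma (star s) v) = (1 - r)%:C *: v.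
Hypothesis s_u : forall v, sigma s (sigma u v) = sigma u (sigma s v).
Hypothesis s'_u : forall v, sigma (star s) (sigma u v) = sigma u (sigma (star s) v).

Let s_u' v : sigma s (sigma (star u) v) = sigma (star u) (sigma s v).
Proof. by have := rep_comm_star s'_u v; rewrite starK. Qed.

Let s'_u' v : sigma (star s) (sigma (star u) v) = sigma (star u) (sigma (star s) v).
Proof. exact: rep_comm_star. Qed.

Let S_adj v w : inner (sigma s v) w = inner v (sigma (star s) w).
Proof. exact: rep_star. Qed.

Lemma defectE v : sigma (1 - s * star s) v = v - sigma s (sigma (star s) v).
Proof. by rewrite -scaleN1r repD repZ rep1 repM scaleN1r. Qed.

(** The kernel of the defect is invariant: the defect commutes with [u] and [star u], and it
    commutes with [s] and [star s] up to the factor [r], which is nonzero. *)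
Lemma defect_dichotomy :
  (forall v, sigma (1 - s * star s) v = 0 -> v = 0) \/
  (forall v, sigma (1 - s * star s) v = 0).
Proof.
apply: (ker_irreducible irr); first exact: rep_bounded_map.
have r0 : r%:C != 0 :> R[i].
  rewrite -(rmorph0 (real_complex R)) (inj_eq (@complexI _)).
  by case/andP: r01 => /gt_eqF ->.
move=> x v; apply: (gen_stable (V := [set v | sigma (1 - s * star s) v = 0])) => /=.
- by move=> c v1 v2 E1 E2; rewrite linearP E1 E2 scaler0 addr0.
- exact: linear0.
- by move=> {}v Ev; rewrite (defectS relS defectE) Ev linear0 scaler0.
- move=> {}v Ev; apply/eqP; have /eqP := defectS' relS defectE v.
  by rewrite Ev linear0 scaler_eq0 (negPf r0).
- move=> {}v; rewrite !defectE s'_u s_u -linearB => ->; exact: linear0.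
- move=> {}v; rewrite !defectE s'_u' s_u' -linearB => ->; exact: linear0.
Qed.

Lemma shift_case :
  (exists v, sigma (1 - s * star s) v != 0) ->
  (forall v, sigma (star u) (sigma u v) = v) ->
  (forall v, sigma u (sigma (star u) v) = v) ->
  exists2 t : R, 0 <= t < 2 * pi & exists2 f : nat -> K, orthonormal_basis f &
    forall k, sigma s (f k) = (shift_coef r k)%:C *: f k.+1 /\
              sigma u (f k) = expi t *: f k.
Proof.
move=> Xn0 u'u uu'; have [w0 w0n0 Sw0] :=
  vacuum_exists r01 S_adj (rep_bounded_map sigma s) relS defectE Xn0.
(* Commutation of [u] with [star u] is its unitarity; commutation with [s] and [star s] is
   assumed. *)
have uc : forall y v, sigma u (sigma y v) = sigma y (sigma u v).
  apply: gen_comm => //.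
  by move=> v; rewrite uu' u'u.
have [t t2 ut] := central_unitary uc u'u; exists t => //.
have [d w1] := normalize w0n0; set w := d *: w0 in w1.
have Sw : sigma (star s) w = 0 by rewrite /w linearZ_LR /= Sw0 scaler0.
pose f := shift_vec r (sigma s) w.
have fo : orthonormal_seq f := shift_vec_orthonormal r01 S_adj relS Sw w1.
have Sf k : sigma s (f k) = (shift_coef r k)%:C *: f k.+1 by exact: shift_vecS.
exists f; last by move=> k; rewrite Sf; case: (ut (f k)).
split=> //; rewrite -/(fspan f).
have cf := closure_fspan_subspace f; have [_ cf0 cfP] := cf.
have fZ c k : fspan f (c *: f k).
  by rewrite -[c *: f k]addr0; apply: fspanZD; [exact: fspan_mem|exact: fspan0].
have scal c v : closure (fspan f) v -> closure (fspan f) (c *: v).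
  by move=> cv; rewrite -[c *: v]addr0; exact: cfP.
(* The generators and their adjoints send each [f k] to a multiple of a neighbour, of itself, or to
   zero, so the closed span is invariant; it contains the unit vector [w]. *)
have [] := irr cf.
- apply: gen_stable => // v fv.
  + apply: closure_stable fv; first exact: rep_bounded_map.
    by apply: fspan_stable => k; rewrite Sf.
  + apply: closure_stable fv; first exact: rep_bounded_map.
    apply: fspan_stable => -[|k]; first by rewrite [f 0%N]/= Sw; exact: fspan0.
    by rewrite (shift_vecS' r01 relS Sw); exact: fZ.
  + by rewrite (ut v).1; exact: scal.
  + by rewrite (ut v).2; exact: scal.
- move=> f0; have : closure (fspan f) w.
    by apply: subset_closure; exact: (fspan_mem f 0).
  rewrite f0 /= => w00; move/eqP: w1; rewrite w00 inner0l eq_sym.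
  by rewrite oner_eq0.
- by [].
Qed.

End Classification.

(** The index maps [ia] and [ib] let one statement serve both infinite families: one is the
    successor, the other the identity. *)
Lemma equivalent_on_basis (R : realType) (p q : R) (K H : hilbertType R)
    (sigma : star_rep (Osphere p q) K) (rho : star_rep (Osphere p q) H)
    (f : nat -> K) (e : nat -> H) (ca cb : nat -> R[i]) (ia ib : nat -> nat) :
  orthonormal_basis f -> orthonormal_basis e ->
  (forall k, sigma (gen_a p q) (f k) = ca k *: f (ia k)) ->
  (forall k, sigma (gen_b p q) (f k) = cb k *: f (ib k)) ->
  (forall k, rho (gen_a p q) (e k) = ca k *: e (ia k)) ->
  (forall k, rho (gen_b p q) (e k) = cb k *: e (ib k)) ->
  unitarily_equivalent sigma rho.
Proof.
move=> hf he sa sb ra rb; have [U [bU Ui Us Ue]] := basis_unitary hf he.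
have ext x (c : nat -> R[i]) (i : nat -> nat) :
    (forall k, sigma x (f k) = c k *: f (i k)) ->
    (forall k, rho x (e k) = c k *: e (i k)) ->
    (U \o sigma x) =1 (rho x \o U).
  move=> sx rx; apply: (basis_ext hf).
  - by apply: bounded_map_comp => //; exact: rep_bounded_map.
  - by apply: bounded_map_comp => //; exact: rep_bounded_map.
  - by move=> k /=; rewrite sx linearZ_LR /= !Ue rx.
apply: (unitarily_equivalent_gen Ui Us); [exact: ext sa ra|exact: ext sb rb].
Qed.


Theorem theorem2p1 (R : realType) (p q : R) (hp : 0 < p < 1) (hq : 0 < q < 1)
    (H : hilbertType R) (e : nat -> H) (he : orthonormal_basis e) :
  (* the formulas define representations *)
  [/\ forall theta : R, 0 <= theta < 2 * pi ->
        exists rho : star_rep (Osphere p q) H, is_rho1 e theta rho,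
      forall theta : R, 0 <= theta < 2 * pi ->
        exists rho : star_rep (Osphere p q) H, is_rho2 e theta rho
    & forall theta1 theta2 : R,
        0 <= theta1 < 2 * pi -> 0 <= theta2 < 2 * pi ->
        exists rho : star_rep (Osphere p q) (complex_line R),
          is_rho12 theta1 theta2 rho]
  /\
  (* every irreducible representation is equivalent to one of them *)
  (forall (K : hilbertType R) (sigma : star_rep (Osphere p q) K),
    irreducible sigma ->
    [\/ exists2 theta : R, 0 <= theta < 2 * pi &
          exists2 rho : star_rep (Osphere p q) H,
            is_rho1 e theta rho & unitarily_equivalent sigma rho,
        exists2 theta : R, 0 <= theta < 2 * pi &
          exists2 rho : star_rep (Osphere p q) H,
            is_rho2 e theta rho & unitarily_equivalent sigma rho
      | exists theta1 theta2 : R,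
          [/\ 0 <= theta1 < 2 * pi, 0 <= theta2 < 2 * pi
            & exists2 rho : star_rep (Osphere p q) (complex_line R),
                is_rho12 theta1 theta2 rho & unitarily_equivalent sigma rho]]).
Proof.
split; first split=> [t _|t _|t1 t2 _ _].
- exact: rho1_exists.
- exact: rho2_exists.
- exact: rho12_exists.
move=> K sigma irr; set a := gen_a p q; set b := gen_b p q.
have [ra rb rab rsab rp] := Osphere_rel p q; rewrite -/a -/b in ra rb rab rsab rp.
have rel_of r (s : Osphere p q) :
    star s * s - r%:C *: (s * star s) = (1 - r)%:C *: 1 ->
    forall v, sigma (star s) (sigma s v) - r%:C *: sigma s (sigma (star s) v) =
      (1 - r)%:C *: v.
  move=> E v; have := congr1 (fun x => rep sigma x v) E.
  by rewrite /= -scaleN1r repD !repZ rep1 !repM scaleN1r.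
have relA := rel_of _ _ ra; have relB := rel_of _ _ rb.
have ab v : sigma a (sigma b v) = sigma b (sigma a v) by rewrite -!repM rab.
have a'b v : sigma (star a) (sigma b v) = sigma b (sigma (star a) v).
  by rewrite -!repM rsab.
have ba v : sigma b (sigma a v) = sigma a (sigma b v) by rewrite ab.
have b'a v : sigma (star b) (sigma a v) = sigma a (sigma (star b) v).
  by have := rep_comm_star a'b v; rewrite starK => <-.
have unitary r (s : Osphere p q) : (forall v, sigma (star s) (sigma s v) -
      r%:C *: sigma s (sigma (star s) v) = (1 - r)%:C *: v) ->
    (forall v, sigma (1 - s * star s) v = 0) ->
    (forall v, sigma s (sigma (star s) v) = v) /\
    (forall v, sigma (star s) (sigma s v) = v).
  move=> rS Y0; have ss' v : sigma s (sigma (star s) v) = v.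
    by apply/esym/subr0_eq; rewrite -defectE.
  (* Once [s * star s] acts as [1], the relation says that [star s * s] acts as [r + (1 - r)]. *)
  split=> // v; have /eqP := rS v; rewrite ss' subr_eq -scalerDl -rmorphD subrK.
  by rewrite rmorph1 scale1r => /eqP.
have gab : a = gen_a p q /\ b = gen_b p q \/ a = gen_b p q /\ b = gen_a p q.
  by left.
have gba : b = gen_a p q /\ a = gen_b p q \/ b = gen_b p q /\ a = gen_a p q.
  by right.
have [v1 v1n0] := rep_nonzero sigma.
have neq0 x : (forall v, sigma x v = 0 -> v = 0) -> exists v, sigma x v != 0.
  by move=> inj; exists v1; apply: contra v1n0 => /eqP /inj ->.
have [Xinj|X0] := defect_dichotomy irr gab hq relA ab a'b.
  (* The product of the two defects vanishes, so injectivity of the first kills the second: [b] is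
     unitary and [a] is the shift. *)
  have Y0 v : sigma (1 - b * star b) v = 0.
    by apply: Xinj; rewrite -repM rp -(scale0r 1) repZ scale0r.
  have [bb' b'b] := unitary _ _ relB Y0.
  have [t t2 [f hf fE]] := shift_case irr gab hq relA ab a'b (neq0 _ Xinj) b'b bb'.
  constructor 2; exists t => //.
  have [rho rhoE] := rho2_exists p hq t he; exists rho => //.
  by apply: (equivalent_on_basis hf he (ca := fun k => (shift_coef q k)%:C)
    (cb := fun=> expi t) (ia := S) (ib := id)) => k;
    case: (fE k) => // fa fb; case: (rhoE k).
have [aa' a'a] := unitary _ _ relA X0.
(* Now [a] is unitary; the same dichotomy with the generators exchanged separates the first family
   from the one-dimensional one. *)
have [Yinj|Y0] := defect_dichotomy irr gba hp relB ba b'a.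
  have [t t2 [f hf fE]] := shift_case irr gba hp relB ba b'a (neq0 _ Yinj) a'a aa'.
  constructor 1; exists t => //.
  have [rho rhoE] := rho1_exists q hp t he; exists rho => //.
  by apply: (equivalent_on_basis hf he (cb := fun k => (shift_coef p k)%:C)
    (ca := fun=> expi t) (ib := S) (ia := id)) => k;
    case: (fE k) => // fb fa; case: (rhoE k).
have [bb' b'b] := unitary _ _ relB Y0.
have ab' v : sigma a (sigma (star b) v) = sigma (star b) (sigma a v) by rewrite b'a.
have ba' v : sigma b (sigma (star a) v) = sigma (star a) (sigma b v) by rewrite a'b.
have ac y v : sigma a (sigma y v) = sigma y (sigma a v).
  by apply: (gen_comm gab) => {}v //; rewrite aa' a'a.
have bc y v : sigma b (sigma y v) = sigma y (sigma b v).
  by apply: (gen_comm gab) => {}v //; rewrite bb' b'b.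
have [t1 t12 at1] := central_unitary irr ac a'a.
have [t2 t22 bt2] := central_unitary irr bc b'b.
constructor 3; exists t1, t2; split=> //.
have [rho rhoE] := rho12_exists p q t1 t2; exists rho => //.
have [|w w1 wE] := scalar_line irr gab.
  move=> x; rewrite !inE => /or4P[] /eqP ->.
  - by exists (expi t1) => v; case: (at1 v).
  - by exists (Num.conj (expi t1)) => v; case: (at1 v).
  - by exists (expi t2) => v; case: (bt2 v).
  - by exists (Num.conj (expi t2)) => v; case: (bt2 v).
(* Every vector is a multiple of the unit vector [w], so its coordinate along [w] is the required
   unitary. *)
have [|U UE] := @linear_pack R K (complex_line R) (fun v => inner v w).
  by move=> c u v; rewrite innerDl innerZl.
apply: (unitarily_equivalent_gen (U := U)).
- move=> u v; rewrite [in RHS](wE u) [in RHS](wE v) innerZl innerZr w1 mulr1.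
  by rewrite !UE.
- by move=> z; exists ((z : R[i]) *: w); rewrite UE innerZl w1 mulr1.
- by move=> v; rewrite (at1 v).1 linearZ_LR /= (rhoE _).1.
- by move=> v; rewrite (bt2 v).1 linearZ_LR /= (rhoE _).2.
Qed.
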